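(* There exists a deterministic $1$-local $O(1)$-memory routing algorithm on the graph $G_{12}$ such that for every finite point set $P$ in general position and all $u,w\in P$ with $w$ in a positive cone of $u$, the path followed in $G_{12}$ has length at most (i) $19\cdot 2\cdot|uw|=38|uw|$ when routing from $u$ to $w$, and (ii) $19\cdot\tfrac{5}{\sqrt{3}}\cdot|uw|$ when routing from $w$ to $u$.
   Context: Cones: for a point $u$, the plane is partitioned into six cones with apex $u$, bounded by the rays from $u$ at angles $j\pi/3$ ($j=0,\dots,5$) from the positive $x$-axis; counterclockwise from the positive $x$-axis they are $\overline{C}_1, C_0, \overline{C}_2, C_1, \overline{C}_0, C_2$; $C_0,C_1,C_2$ are positive and the others negative. General position: no two points of $P$ lie on a line parallel to a cone boundary ray. Half-$\theta_6$-graph $H$ of $P$: for each $u$ and each positive cone $C$ of $u$ containing other points, add an edge from $u$ to the point of $P$ in $C$ whose orthogonal projection onto the bisector of $C$ is closest to $u$; edges weighted by Euclidean length. Every edge of $H$ joins $u$ to a point $v$ lying in a negative cone of $u$ (and $u$ in a positive cone of $v$). Graph $G_{12}$: for each vertex $u$ and each negative cone $\overline{C}$ of $u$, consider the neighbours of $u$ in $H$ lying in $\overline{C}$; mark the edges from $u$ to the first and the last of these in clockwise order around $u$, and to the one whose orthogonal projection onto the bisector of $\overline{C}$ is closest to $u$. $G_{12}$ is the subgraph of $H$ consisting of all marked edges (an edge is kept iff it is marked by some vertex). Routing model: vertices identified by coordinates; a deterministic $1$-local $m$-memory routing algorithm forwards a message from the current vertex $s$ to a neighbour of $s$ in $G_{12}$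 chosen as a deterministic function of $s$, the destination $t$, the neighbours of $s$ in $G_{12}$ (with coordinates), and a memory of $m$ units stored with the message (a unit being a $\lceil\log_2 n\rceil$-bit integer or a point of $\mathbb{R}^2$), which it may update. Path length is the sum of Euclidean edge lengths traversed until reaching the destination. *)

(* Defs.v *)
From Stdlib Require Import Reals List Lra.
Open Scope R_scope.

Definition point : Type := (R * R)%type.

Definition psub (p q : point) : point := (fst p - fst q, snd p - snd q).
Definition dot (a b : point) : R := fst a * fst b + snd a * snd b.
Definition cross (a b : point) : R := fst a * snd b - snd a * fst b.

Definition edist (p q : point) : R :=
  sqrt ((fst p - fst q) ^ 2 + (snd p - snd q) ^ 2).

Definition ray_dir (j : nat) : point :=
  (cos (INR j * PI / 3), sin (INR j * PI / 3)).

Definition bis_dir (j : nat) : point :=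
  (cos ((2 * INR j + 1) * PI / 6), sin ((2 * INR j + 1) * PI / 6)).

(** v lies in the open sector j (0 <= j < 6) with apex u, i.e. the direction
    of v - u has angle strictly between j*pi/3 and (j+1)*pi/3.
    Counterclockwise from the positive x-axis the sectors 0..5 are
    Cbar_1, C_0, Cbar_2, C_1, Cbar_0, C_2. *)
Definition in_sector (j : nat) (u v : point) : Prop :=
  0 < cross (ray_dir j) (psub v u) /\ 0 < cross (psub v u) (ray_dir (S j)).

Definition positive_sector (j : nat) : Prop := j = 1%nat \/ j = 3%nat \/ j = 5%nat.
Definition negative_sector (j : nat) : Prop := j = 0%nat \/ j = 2%nat \/ j = 4%nat.

Definition in_positive_cone (u v : point) : Prop :=
  exists j, positive_sector j /\ in_sector j u v.

(** General position: no two points of P on a line parallel to a cone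
    boundary ray (the rays lie on the three lines of directions 0, pi/3, 2pi/3). *)
Definition general_position (P : list point) : Prop :=
  forall p q, In p P -> In q P -> p <> q ->
    forall j, (j < 3)%nat -> cross (ray_dir j) (psub q p) <> 0.

Definition theta_edge (P : list point) (u v : point) : Prop :=
  In u P /\ In v P /\
  exists j, positive_sector j /\ in_sector j u v /\
    forall w, In w P -> in_sector j u w ->
      dot (psub v u) (bis_dir j) <= dot (psub w u) (bis_dir j).

Definition H_adj (P : list point) (x y : point) : Prop :=
  theta_edge P x y \/ theta_edge P y x.

Definition H_nbr_in (P : list point) (j : nat) (u v : point) : Prop :=
  H_adj P u v /\ in_sector j u v.

Definition marks (P : list point) (u v : point) : Prop :=
  exists j, negative_sector j /\ H_nbr_in P j u v /\
   ( (* first in clockwise order: no such neighbour strictly counterclockwise of v *)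
     (forall v', H_nbr_in P j u v' -> cross (psub v u) (psub v' u) <= 0)
   \/ (* last in clockwise order: no such neighbour strictly clockwise of v *)
     (forall v', H_nbr_in P j u v' -> 0 <= cross (psub v u) (psub v' u))
   \/
     (forall v', H_nbr_in P j u v' ->
        dot (psub v u) (bis_dir j) <= dot (psub v' u) (bis_dir j)) ).

Definition G12_adj (P : list point) (x y : point) : Prop :=
  marks P x y \/ marks P y x.

Definition G12_nbrs (P : list point) (s : point) : point -> Prop :=
  fun y => In y P /\ G12_adj P s y.

Inductive mem_unit : Type :=
  | MInt : nat -> mem_unit
  | MPt : point -> mem_unit.

Definition memory : Type := list mem_unit.

Definition mem_ok (m n : nat) (M : memory) : Prop :=
  (length M <= m)%nat /\
  forall k, In (MInt k) M -> (k < 2 ^ Nat.log2_up n)%nat.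

(** A deterministic 1-local routing algorithm with memory:
    [r_init s t] is the memory attached to the message at the source s with
    destination t; [r_step s t N M] returns the next vertex and the updated
    memory, as a function of the current vertex s, the destination t, the set
    N of G_12-neighbours of s (with coordinates) and the current memory M. *)
Record routing_alg : Type := {
  r_init : point -> point -> memory;
  r_step : point -> point -> (point -> Prop) -> memory -> point * memory
}.

Fixpoint route_state (A : routing_alg) (P : list point) (s t : point) (i : nat)
  : point * memory :=
  match i with
  | O => (s, r_init A s t)
  | S i' =>
      let st := route_state A P s t i' in
      r_step A (fst st) t (G12_nbrs P (fst st)) (snd st)
  end.

Definition route_vertex A P s t i : point := fst (route_state A P s t i).

Fixpoint route_length (A : routing_alg) (P : list point) (s t : point) (k : nat) : R :=
  match k with
  | O => 0
  | S k' => route_length A P s t k'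
            + edist (route_vertex A P s t k') (route_vertex A P s t k)
  end.

Definition routes_within (A : routing_alg) (m : nat) (P : list point)
    (s t : point) (L : R) : Prop :=
  exists k,
    route_vertex A P s t k = t /\
    (forall i, (i < k)%nat -> route_vertex A P s t i <> t) /\
    (forall i, (i < k)%nat ->
        G12_nbrs P (route_vertex A P s t i) (route_vertex A P s t (S i))) /\
    (forall i, (i <= k)%nat -> mem_ok m (length P) (snd (route_state A P s t i))) /\
    route_length A P s t k <= L.

(* Main.v *)
Require Import Defs.
From Stdlib Require Import Reals List.
From Stdlib Require Import Lra Lia Classical ClassicalEpsilon.
Import ListNotations.
Open Scope R_scope.

(** Projecting on the bisectors of the three positive cones gives coordinates [G I0 + G
    I1 + G I2 = 0] in which positive cone [i] of [s] is the set where the other two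
    coordinates are smaller than at [s]; the three indices are then interchangeable.

    The H-neighbours of [p] in its negative cone [i] ("children") form an antichain in
    the other two coordinates, and consecutive ones are joined by an edge that one
    of them marks as its first or last one. A vertex whose edge to its parent is
    missing in G12 thus finds, by a doubling search along this path, the child
    closest to the parent. This child is at distance at most twice the height of the
    edge, the search costs a factor 9, and the last edge at most the height: hence
    19 = 2 * 9 + 1.

    On H one routes to [t] as follows. If [t] is in a positive cone, take the edge in
    it. If [t] is in negative cone [k], the triangle with apex [t] and [s] on the
    opposite side meets the positive cones [j] and [e] of [s]. Prefer a child of [s]
    in the triangle, the one nearest to cone [e]; otherwise go to the parent in cone
    [j]. Once the triangle has no point in cone [e] of [s], this remains so and such
    a step exists, and the length is bounded by the side of the triangle plus its
    part in cone [j]. After a step in a positive cone this emptiness holds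
    automatically. If the message starts in the negative case, [j] is chosen to be
    the shorter part; when the parent in cone [j] turns out to be outside the
    triangle, or is not found within the radius that any parent inside would
    require, the message returns and exchanges the roles of [j] and [e]. The failed
    search is paid for by the unused part in cone [j], and happens at most once. *)

(** * Triangular coordinates *)

Inductive idx : Type := I0 | I1 | I2.

Definition G (i : idx) (p : point) : R :=
  match i with
  | I0 => 2 * (snd p / sqrt 3)
  | I1 => - fst p - snd p / sqrt 3
  | I2 => fst p - snd p / sqrt 3
  end.

Definition distinct (i j k : idx) : Prop := i <> j /\ j <> k /\ i <> k.

Definition inC (i : idx) (s p : point) : Prop :=
  forall j, j <> i -> G j p < G j s.

Lemma sqrt3_pos : 0 < sqrt 3.
Proof. apply sqrt_lt_R0; lra. Qed.

Lemma sqrt3_sqr : sqrt 3 * sqrt 3 = 3.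
Proof. apply sqrt_sqrt; lra. Qed.

Lemma G_sum i j k p : distinct i j k -> G i p + G j p + G k p = 0.
Proof.
  unfold distinct.
  destruct i, j, k; intros (?&?&?); try congruence; simpl; lra.
Qed.

Lemma distinct_cases i j k : distinct i j k -> forall l, l = i \/ l = j \/ l = k.
Proof.
  unfold distinct.
  destruct i, j, k; intros (?&?&?) []; try congruence; auto.
Qed.

Lemma inC_iff i j k s p :
  distinct i j k -> (inC i s p <-> G j p < G j s /\ G k p < G k s).
Proof.
  intros D; split.
  - intros H; destruct D as (?&?&?); split; apply H; congruence.
  - intros [H1 H2] l Hl.
    destruct (distinct_cases _ _ _ D l) as [->|[->| ->]]; congruence || assumption.
Qed.

Lemma distinct_perm i j k :
  distinct i j k ->
  distinct i k j /\ distinct j i k /\ distinct j k i /\ distinct k i j /\ distinct k j i.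
Proof. unfold distinct; intuition congruence. Qed.

Lemma distinct_ex i : exists j k, distinct i j k.
Proof.
  unfold distinct.
  destruct i; [exists I1, I2|exists I0, I2|exists I0, I1]; intuition congruence.
Qed.

Lemma distinct_ex2 i j : i <> j -> exists k, distinct i j k.
Proof.
  unfold distinct; destruct i, j; intros H; try congruence;
    [exists I2|exists I1|exists I2|exists I0|exists I1|exists I0]; intuition congruence.
Qed.

(** The coordinates are scaled so that a displacement along a cone boundary ray is as long as each
    of the two coordinate changes it causes; the formula is then the law of cosines for 120
    degrees. *)
Lemma edist_sqr i j p q : i <> j ->
  edist p q = sqrt ((G i p - G i q) ^ 2 + (G i p - G i q) * (G j p - G j q)
                    + (G j p - G j q) ^ 2).
Proof.
  intros N; unfold edist; f_equal.
  pose proof sqrt3_pos as H3.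
  pose proof sqrt3_sqr as H4.
  destruct p as [x y], q as [x' y']; cbv beta iota delta [G]; simpl.
  assert (Y : y = sqrt 3 * (y / sqrt 3)) by (field; lra).
  assert (Y' : y' = sqrt 3 * (y' / sqrt 3)) by (field; lra).
  set (a := y / sqrt 3) in *; set (b := y' / sqrt 3) in *; clearbody a b.
  replace ((y - y') * ((y - y') * 1)) with ((sqrt 3 * sqrt 3) * (a - b) ^ 2)
    by (rewrite Y, Y'; ring).
  rewrite H4; destruct i, j; try congruence; ring.
Qed.

Lemma sqrt_le_of_sqr x y : 0 <= y -> x <= y ^ 2 -> sqrt x <= y.
Proof.
  intros Hy H. rewrite <- (sqrt_pow2 y Hy). apply sqrt_le_1_alt, H.
Qed.

Lemma edist_sym p q : edist p q = edist q p.
Proof. unfold edist; f_equal; ring. Qed.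

Lemma edist_pos p q : p <> q -> 0 < edist p q.
Proof.
  intros N; unfold edist; apply sqrt_lt_R0.
  destruct p as [x y], q as [x' y']; simpl.
  destruct (Req_dec x x'); destruct (Req_dec y y'); subst; try congruence; nra.
Qed.

Lemma edist_inC i s p : inC i s p -> edist s p <= G i p - G i s.
Proof.
  intros H. destruct (distinct_ex i) as (j & k & D).
  pose proof (G_sum _ _ _ s D); pose proof (G_sum _ _ _ p D).
  apply (inC_iff i j k) in H; auto; destruct H.
  rewrite (edist_sqr j k) by apply D.
  apply sqrt_le_of_sqr; [lra|].
  replace (G i p - G i s) with ((G j s - G j p) + (G k s - G k p)) by lra. nra.
Qed.

(** The two differences have opposite signs, as between siblings: the square is a^2 - ab + b^2 with
    a, b nonnegative, hence at most (a + b)^2. *)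
Lemma edist_opp j k p q : j <> k ->
  G j p <= G j q -> G k q <= G k p ->
  edist p q <= (G j q - G k q) - (G j p - G k p).
Proof.
  intros N H1 H2. rewrite (edist_sqr j k) by assumption.
  apply sqrt_le_of_sqr; [lra|].
  replace (G j q - G k q - (G j p - G k p)) with ((G j q - G j p) + (G k p - G k q)) by lra.
  nra.
Qed.

(** [sqrt 3 / 2] times [G i] is the projection on the bisector of sector [pos_sec i],
    which is opposite to sector [neg_sec i]. *)
Definition pos_sec (i : idx) : nat :=
  match i with I0 => 1 | I1 => 3 | I2 => 5 end.
Definition neg_sec (i : idx) : nat :=
  match i with I0 => 4 | I1 => 0 | I2 => 2 end.

(** * Sectors, bisectors and general position in the three coordinates *)

Lemma ray_dir_values :
  ray_dir 0 = (1, 0) /\ ray_dir 1 = (1 / 2, sqrt 3 / 2) /\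
  ray_dir 2 = (- (1 / 2), sqrt 3 / 2) /\ ray_dir 3 = (- 1, 0) /\
  ray_dir 4 = (- (1 / 2), - (sqrt 3 / 2)) /\ ray_dir 5 = (1 / 2, - (sqrt 3 / 2)) /\
  ray_dir 6 = (1, 0).
Proof.
  pose proof cos_PI3 as C; pose proof sin_PI3 as S.
  unfold ray_dir; simpl INR.
  repeat split.
  - replace (0 * PI / 3) with 0 by field. now rewrite cos_0, sin_0.
  - replace (1 * PI / 3) with (PI / 3) by field. now rewrite C, S.
  - replace ((1 + 1) * PI / 3) with (- (PI / 3) + PI) by field.
    rewrite neg_cos, neg_sin, cos_neg, sin_neg, C, S. f_equal; ring.
  - replace ((1 + 1 + 1) * PI / 3) with PI by field. now rewrite cos_PI, sin_PI.
  - replace ((1 + 1 + 1 + 1) * PI / 3) with (PI / 3 + PI) by field.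
    now rewrite neg_cos, neg_sin, C, S.
  - replace ((1 + 1 + 1 + 1 + 1) * PI / 3) with (- (PI / 3) + 2 * PI) by field.
    rewrite cos_plus, sin_plus, cos_neg, sin_neg, cos_2PI, sin_2PI, C, S. f_equal; ring.
  - replace ((1 + 1 + 1 + 1 + 1 + 1) * PI / 3) with (2 * PI) by field.
    now rewrite cos_2PI, sin_2PI.
Qed.

Lemma bis_dir_values :
  bis_dir 0 = (sqrt 3 / 2, 1 / 2) /\ bis_dir 1 = (0, 1) /\
  bis_dir 2 = (- (sqrt 3 / 2), 1 / 2) /\ bis_dir 3 = (- (sqrt 3 / 2), - (1 / 2)) /\
  bis_dir 4 = (0, - 1) /\ bis_dir 5 = (sqrt 3 / 2, - (1 / 2)).
Proof.
  pose proof cos_PI6 as C; pose proof sin_PI6 as S.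
  unfold bis_dir; simpl INR.
  repeat split.
  - replace ((2 * 0 + 1) * PI / 6) with (PI / 6) by field. now rewrite C, S.
  - replace ((2 * 1 + 1) * PI / 6) with (PI / 2) by field. now rewrite cos_PI2, sin_PI2.
  - replace ((2 * (1 + 1) + 1) * PI / 6) with (- (PI / 6) + PI) by field.
    rewrite neg_cos, neg_sin, cos_neg, sin_neg, C, S. f_equal; ring.
  - replace ((2 * (1 + 1 + 1) + 1) * PI / 6) with (PI / 6 + PI) by field.
    now rewrite neg_cos, neg_sin, C, S.
  - replace ((2 * (1 + 1 + 1 + 1) + 1) * PI / 6) with (PI / 2 + PI) by field.
    rewrite neg_cos, neg_sin, cos_PI2, sin_PI2. f_equal; ring.
  - replace ((2 * (1 + 1 + 1 + 1 + 1) + 1) * PI / 6) with (- (PI / 6) + 2 * PI) by field.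
    rewrite cos_plus, sin_plus, cos_neg, sin_neg, cos_2PI, sin_2PI, C, S. f_equal; ring.
Qed.

Lemma in_sector_G j u v :
  (forall i, j = pos_sec i -> (in_sector j u v <-> inC i u v)) /\
  (forall i, j = neg_sec i -> (in_sector j u v <-> inC i v u)).
Proof.
  destruct ray_dir_values as (R0 & R1 & R2 & R3 & R4 & R5 & R6).
  pose proof sqrt3_pos as H3.
  destruct u as [x y], v as [x' y'].
  assert (Y : y = sqrt 3 * (y / sqrt 3)) by (field; lra).
  assert (Y' : y' = sqrt 3 * (y' / sqrt 3)) by (field; lra).
  assert (D01 : distinct I0 I1 I2) by (repeat split; congruence).
  destruct (distinct_perm _ _ _ D01) as (_ & D1 & _ & D2 & _).
  split; intros i ->; unfold in_sector, cross, psub; destruct i; simpl pos_sec; simpl neg_sec;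
    rewrite ?R0, ?R1, ?R2, ?R3, ?R4, ?R5, ?R6;
    first [rewrite (inC_iff _ _ _ _ _ D01)|rewrite (inC_iff _ _ _ _ _ D1)
          |rewrite (inC_iff _ _ _ _ _ D2)];
    cbn [fst snd G];
    set (a := y / sqrt 3) in *; set (b := y' / sqrt 3) in *; rewrite Y, Y'; clearbody a b;
    (split; intros [? ?]; split; nra).
Qed.

Lemma in_sector_pos i u v : in_sector (pos_sec i) u v <-> inC i u v.
Proof. now apply (in_sector_G (pos_sec i) u v). Qed.

Lemma in_sector_neg i u v : in_sector (neg_sec i) u v <-> inC i v u.
Proof. now apply (in_sector_G (neg_sec i) u v). Qed.

Lemma pos_sec_iff j : positive_sector j <-> exists i, j = pos_sec i.
Proof.
  unfold positive_sector; split.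
  - intros [->|[->| ->]]; [exists I0|exists I1|exists I2]; reflexivity.
  - intros [[] ->]; simpl; auto.
Qed.

Lemma neg_sec_iff j : negative_sector j <-> exists i, j = neg_sec i.
Proof.
  unfold negative_sector; split.
  - intros [->|[->| ->]]; [exists I1|exists I2|exists I0]; reflexivity.
  - intros [[] ->]; simpl; auto.
Qed.

Lemma dot_bis_dir i u v :
  dot (psub v u) (bis_dir (pos_sec i)) = sqrt 3 / 2 * (G i v - G i u) /\
  dot (psub v u) (bis_dir (neg_sec i)) = sqrt 3 / 2 * (G i u - G i v).
Proof.
  destruct bis_dir_values as (B0 & B1 & B2 & B3 & B4 & B5).
  pose proof sqrt3_pos as H3. pose proof sqrt3_sqr as H4.
  destruct u as [x y], v as [x' y'].
  unfold dot, psub; destruct i; simpl pos_sec; simpl neg_sec;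
    rewrite ?B0, ?B1, ?B2, ?B3, ?B4, ?B5; cbn [fst snd G]; split; field; lra.
Qed.

(** A linear change of coordinates multiplies determinants by a constant. Its sign, the orientation
    of [(j, k)], may stay open because the first and the last neighbour are both marked. *)
Lemma cross_G i j k : distinct i j k ->
  exists c, (c = sqrt 3 / 2 \/ c = - (sqrt 3 / 2)) /\
  forall u v w, cross (psub v u) (psub w u)
    = c * ((G j v - G j u) * (G k w - G k u) - (G k v - G k u) * (G j w - G j u)).
Proof.
  pose proof sqrt3_pos as H3.
  unfold distinct, cross, psub.
  destruct i, j, k; intros (?&?&?); try congruence;
    (exists (sqrt 3 / 2); split; [now left|]; intros [x y] [x' y'] [x2 y2];
     cbn [fst snd G]; field; lra) ||
    (exists (- (sqrt 3 / 2)); split; [now right|]; intros [x y] [x' y'] [x2 y2];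
     cbn [fst snd G]; field; lra).
Qed.

Lemma general_position_G P : general_position P ->
  forall i p q, In p P -> In q P -> G i p = G i q -> p = q.
Proof.
  intros GP i p q Hp Hq E. apply NNPP; intros N.
  destruct ray_dir_values as (R0 & R1 & R2 & _).
  pose proof sqrt3_pos as H3.
  (* The lines on which [G I0], [G I1], [G I2] are constant are parallel to rays 0, 2, 1. *)
  destruct i; [apply (GP p q Hp Hq N 0%nat)|apply (GP p q Hp Hq N 2%nat)
              |apply (GP p q Hp Hq N 1%nat)]; try lia;
    rewrite ?R0, ?R1, ?R2; revert E; unfold cross, psub; destruct p as [x y], q as [x' y'];
    cbn [fst snd G]; intros E.
  - assert (A : sqrt 3 * (y' / sqrt 3) = sqrt 3 * (y / sqrt 3)) by nra.
    replace (sqrt 3 * (y' / sqrt 3)) with y' in A by (field; lra).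
    replace (sqrt 3 * (y / sqrt 3)) with y in A by (field; lra). lra.
  - replace (- (1 / 2) * (y' - y) - sqrt 3 / 2 * (x' - x)) with
      (sqrt 3 / 2 * ((- x' - y' / sqrt 3) - (- x - y / sqrt 3))) by (field; lra).
    rewrite <- E; ring.
  - replace (1 / 2 * (y' - y) - sqrt 3 / 2 * (x' - x)) with
      (- (sqrt 3 / 2) * ((x' - y' / sqrt 3) - (x - y / sqrt 3))) by (field; lra).
    rewrite <- E; ring.
Qed.

(** * Children and the paths they form *)

Lemma list_argmax {A : Type} (P : list A) (Q : A -> Prop) (f : A -> R) :
  (exists q, In q P /\ Q q) ->
  exists q, In q P /\ Q q /\ forall q', In q' P -> Q q' -> f q' <= f q.
Proof.
  induction P as [|a P IH]; intros (q & Hq & HQ); [destruct Hq|].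
  destruct (classic (exists q, In q P /\ Q q)) as [H|H].
  - destruct (IH H) as (m & Hm & Qm & Mm).
    destruct (classic (Q a /\ f m < f a)) as [[Qa L]|N].
    + exists a; split; [now left|split; [assumption|]].
      intros q' [<-|I] Q'; [lra|]. pose proof (Mm _ I Q'); lra.
    + exists m; split; [now right|split; [assumption|]].
      intros q' [<-|I] Q'; [|now apply Mm].
      destruct (Rle_or_lt (f a) (f m)); [assumption|tauto].
  - destruct Hq as [<-|Hq]; [|exfalso; eauto].
    exists a; split; [now left|split; [assumption|]].
    intros q' [<-|I] Q'; [lra|exfalso; eauto].
Qed.

Lemma list_argmin {A : Type} (P : list A) (Q : A -> Prop) (f : A -> R) :
  (exists q, In q P /\ Q q) ->
  exists q, In q P /\ Q q /\ forall q', In q' P -> Q q' -> f q <= f q'.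
Proof.
  intros H; destruct (list_argmax P Q (fun q => - f q) H) as (q & ? & ? & M).
  exists q; split; [assumption|split; [assumption|]].
  intros q' I Q'; specialize (M q' I Q'); lra.
Qed.

Lemma list_pos_lower_bound {A : Type} (P : list A) (Q : A -> Prop) (f : A -> R) :
  (forall q, In q P -> Q q -> 0 < f q) ->
  exists r, 0 < r /\ forall q, In q P -> Q q -> r <= f q.
Proof.
  intros H. destruct (classic (exists q, In q P /\ Q q)) as [E|E].
  - destruct (list_argmin P Q f E) as (q & I & Qq & M); exists (f q); auto.
  - exists 1; split; [lra|]; intros q I Qq; exfalso; eauto.
Qed.

(** The apex [p] need not belong to [P]: a far away [p] turns the vertices whose
    cone [i] is empty into the children of a fictitious parent. *)
Definition child (P : list point) (i : idx) (p c : point) : Prop :=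
  In c P /\ inC i c p /\ forall q, In q P -> inC i c q -> G i p <= G i q.

Definition far (P : list point) (i : idx) (p : point) : Prop :=
  forall q, In q P -> inC i q p.

Definition apex (P : list point) (i : idx) (p : point) : Prop := In p P \/ far P i p.

Lemma inC_up i s p : inC i s p -> G i s < G i p.
Proof.
  destruct (distinct_ex i) as (j & k & D).
  pose proof (G_sum _ _ _ s D); pose proof (G_sum _ _ _ p D).
  rewrite (inC_iff _ _ _ _ _ D); lra.
Qed.

Lemma inC_unique i j s p : inC i s p -> inC j s p -> i = j.
Proof.
  intros H1 H2; apply NNPP; intros N.
  specialize (H2 i N); apply inC_up in H1; lra.
Qed.

Lemma inC_asym i j s p : inC i s p -> inC j p s -> False.
Proof.
  intros H1 H2.
  destruct (classic (i = j)) as [<-|N].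
  - apply inC_up in H1, H2; lra.
  - destruct (distinct_ex2 _ _ N) as [k (A & B & C)].
    specialize (H1 k (not_eq_sym C)); specialize (H2 k (not_eq_sym B)); lra.
Qed.

Lemma theta_edge_iff P u v :
  theta_edge P u v <-> exists i, child P i v u /\ In v P.
Proof.
  pose proof sqrt3_pos as H3.
  unfold theta_edge, child; split.
  - intros (Hu & Hv & j & Hj & S & M).
    apply pos_sec_iff in Hj; destruct Hj as [i ->].
    apply in_sector_pos in S.
    exists i; repeat split; auto. intros q Iq Cq.
    specialize (M q Iq (proj2 (in_sector_pos _ _ _) Cq)).
    rewrite !(proj1 (dot_bis_dir _ _ _)) in M. nra.
  - intros (i & (Hu & C & M) & Hv); repeat split; auto.
    exists (pos_sec i); split; [apply pos_sec_iff; eauto|split; [now apply in_sector_pos|]].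
    intros w Hw Sw. apply in_sector_pos in Sw. specialize (M w Hw Sw).
    rewrite !(proj1 (dot_bis_dir _ _ _)). nra.
Qed.

Lemma adj_sym P x y : G12_adj P x y -> G12_adj P y x.
Proof. unfold G12_adj; tauto. Qed.

Lemma adj_up P x y : G12_adj P x y ->
  In x P /\ In y P /\ ((exists i, child P i y x) \/ (exists i, child P i x y)).
Proof.
  assert (A : forall x y, H_adj P x y ->
    In x P /\ In y P /\ ((exists i, child P i y x) \/ (exists i, child P i x y))).
  { intros a b [H|H]; apply theta_edge_iff in H; destruct H as (i & C & I);
      pose proof C as (? & _); eauto 6. }
  intros [(j & _ & (H & _) & _)|(j & _ & (H & _) & _)]; apply A in H;
    [assumption|tauto].
Qed.

Lemma child_of_adj P i c p : G12_adj P c p -> inC i c p -> child P i p c /\ In p P.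
Proof.
  intros H C; destruct (adj_up _ _ _ H) as (Ic & Ip & [[j K]|[j K]]).
  - pose proof K as (_ & C' & _). rewrite (inC_unique _ _ _ _ C C'); auto.
  - destruct K as (_ & C' & _). destruct (inC_asym _ _ _ _ C C').
Qed.

Section Children.

Context (P : list point).
Context (Ginj : forall i p q, In p P -> In q P -> G i p = G i q -> p = q).

Lemma G_lt_or i p q : In p P -> In q P -> p <> q -> G i p < G i q \/ G i q < G i p.
Proof.
  intros Hp Hq N; destruct (Rtotal_order (G i p) (G i q)) as [H|[H|H]]; auto.
  now apply Ginj in H.
Qed.

Lemma child_unique i p p' c :
  In p P -> In p' P -> child P i p c -> child P i p' c -> p = p'.
Proof.
  intros Ip Ip' (_ & C & M) (_ & C' & M').
  apply (Ginj i); auto. specialize (M p' Ip' C'); specialize (M' p Ip C); lra.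
Qed.

(** Otherwise [a] would lie in cone [i] of [b], closer than the parent [p]. *)
Lemma child_antichain i j k p a b : distinct i j k ->
  child P i p a -> child P i p b -> G j a < G j b -> G k b < G k a.
Proof.
  intros D (Ia & Ca & Ma) (Ib & Cb & Mb) L.
  assert (N : a <> b) by (intros ->; lra).
  destruct (G_lt_or k a b Ia Ib N) as [H|H]; [exfalso|assumption].
  assert (C : inC i b a) by (apply (inC_iff i j k); auto).
  specialize (Mb a Ia C); apply inC_up in Ca; lra.
Qed.

(** This covers all three marks: [m = i] is the closest projection. For the other [m], the antichain
    property makes the child with largest [G m] the one with smallest remaining coordinate, so all
    cross products with it have one sign and it is first or last around [p]. *)
Lemma adj_extreme i p c m : In p P -> child P i p c ->
  (forall c', child P i p c' -> G m c' <= G m c) -> G12_adj P c p.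
Proof.
  intros Ip Cc M. right.
  pose proof sqrt3_pos as H3.
  exists (neg_sec i); split; [apply neg_sec_iff; eauto|].
  assert (A : forall v, H_nbr_in P (neg_sec i) p v -> child P i p v).
  { intros v (H & S); apply in_sector_neg in S.
    destruct H as [H|H]; apply theta_edge_iff in H; destruct H as (i' & K & _);
      pose proof K as (_ & C' & _).
    - destruct (inC_asym _ _ _ _ S C').
    - rewrite (inC_unique _ _ _ _ S C'); assumption. }
  pose proof Cc as (Ic & Ccc & _).
  split.
  { split; [|now apply in_sector_neg].
    right; apply theta_edge_iff; eauto. }
  destruct (classic (m = i)) as [->|N].
  - right; right. intros v Hv; specialize (M v (A v Hv)).
    rewrite !(proj2 (dot_bis_dir _ _ _)). nra.
  - destruct (distinct_ex2 i m (not_eq_sym N)) as [k D].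
    assert (B : forall v, H_nbr_in P (neg_sec i) p v ->
      0 <= (G m c - G m p) * (G k v - G k p) - (G k c - G k p) * (G m v - G m p)).
    { intros v Hv; specialize (A v Hv); specialize (M v A).
      pose proof A as (Iv & Cv & _).
      destruct (proj1 (inC_iff i m k c p D) Ccc) as [? ?].
      destruct (proj1 (inC_iff i m k v p D) Cv) as [? ?].
      assert (G k c <= G k v).
      { destruct (classic (v = c)) as [->|Ne]; [lra|].
        destruct (G_lt_or m v c Iv Ic Ne) as [Lt|Lt]; [|lra].
        apply Rlt_le, (child_antichain i m k p v c); auto. }
      nra. }
    destruct (cross_G i m k D) as (s & [->| ->] & E).
    + right; left. intros v Hv; rewrite E; specialize (B v Hv).
      apply Rmult_le_pos; [lra|assumption].
    + left. intros v Hv; rewrite E; specialize (B v Hv).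
      assert (0 <= sqrt 3 / 2 * ((G m c - G m p) * (G k v - G k p) - (G k c - G k p) * (G m v - G m p))).
      { apply Rmult_le_pos; [lra|assumption]. }
      lra.
Qed.

(** A point of cone [i] of the highest [q] that is below [p] would again satisfy [Q] and be higher.
    This serves to show regions empty: a point there would produce a child there. *)
Lemma highest_is_child i p (Q : point -> Prop) :
  (exists q, In q P /\ Q q) ->
  (forall q, In q P -> Q q -> inC i q p) ->
  (forall q r, In q P -> Q q -> In r P -> inC i q r -> G i r < G i p -> Q r) ->
  exists q, child P i p q /\ Q q.
Proof.
  intros E H1 H2.
  destruct (list_argmax P Q (G i) E) as (q & Iq & Qq & M).
  exists q; split; [|assumption]. repeat split; auto.
  intros r Ir Cr. apply Rnot_lt_le; intros L.
  specialize (M r Ir (H2 _ _ Iq Qq Ir Cr L)). apply inC_up in Cr; lra.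
Qed.

(** The last clause empties the parallelogram between [a] and [b] of all points of [P], not only of
    children. *)
Definition consecutive (i x y : idx) (p a b : point) : Prop :=
  child P i p a /\ child P i p b /\ G x a < G x b /\ G y b < G y a /\
  forall q, In q P -> G x a < G x q < G x b -> G y b < G y q < G y a -> False.

Lemma no_child_between_consecutive i x y p a b : distinct i x y ->
  child P i p a -> child P i p b -> G x a < G x b ->
  (forall c, child P i p c -> G x a < G x c -> G x b <= G x c) ->
  consecutive i x y p a b.
Proof.
  intros D Ca Cb L M.
  assert (L2 : G y b < G y a) by (apply (child_antichain i x y p a b); auto).
  repeat split; auto; [apply Ca|apply Ca|apply Ca|apply Cb|apply Cb|apply Cb|].
  intros q0 I0 X0 Y0.
  pose proof Ca as (Ia & Ka & Ma); pose proof Cb as (Ib & Kb & Mb).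
  destruct (proj1 (inC_iff i x y a p D) Ka) as [? ?].
  destruct (proj1 (inC_iff i x y b p D) Kb) as [? ?].
  destruct (highest_is_child i p
    (fun q => G x a < G x q < G x b /\ G y b < G y q < G y a)) as (q & Cq & ? & ?).
  - exists q0; auto.
  - intros q Iq (? & ?). apply (inC_iff i x y); auto; lra.
  - intros q r Iq (X & Y) Ir Cr Lr.
    destruct (proj1 (inC_iff i x y q r D) Cr) as [? ?].
    assert (Na : a <> r) by (intros <-; lra).
    assert (Nb : b <> r) by (intros <-; lra).
    split; split; try lra.
    + destruct (G_lt_or x a r Ia Ir Na) as [Gl|Gl]; [assumption|exfalso].
      assert (C : inC i a r) by (apply (inC_iff i x y); auto; lra).
      specialize (Ma r Ir C); lra.
    + destruct (G_lt_or y b r Ib Ir Nb) as [Gl|Gl]; [assumption|exfalso].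
      assert (C : inC i b r) by (apply (inC_iff i x y); auto; lra).
      specialize (Mb r Ir C); lra.
  - specialize (M q Cq); lra.
Qed.

(** * Edges between consecutive siblings *)

Section Consecutive.

Context (i x y : idx) (p a b : point).
Context (D : distinct i x y) (Ap : apex P i p) (K : consecutive i x y p a b).
Context (Cab : inC x a b).

Let Dx : distinct x i y.
Proof. apply (distinct_perm _ _ _ D). Qed.
Let Dy : distinct y i x.
Proof. destruct (distinct_perm _ _ _ D) as (? & ? & ? & ? & ?); auto. Qed.

(** A closer point in cone [x] of [a] would lie either in the empty parallelogram or in cone [i] of
    [b] below [p]. *)
Lemma consecutive_up : child P x b a.
Proof.
  destruct K as (Ka & Kb & L & L2 & Box).
  pose proof Ka as (Ia & Ca & Ma); pose proof Kb as (Ib & Cb & Mb).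
  repeat split; auto. intros q Iq Cq. apply Rnot_lt_le; intros Lq.
  destruct (proj1 (inC_iff x i y a q Dx) Cq) as [? ?].
  pose proof (inC_up _ _ _ Cq). pose proof (inC_up _ _ _ Ca).
  assert (N : b <> q) by (intros <-; lra).
  destruct (G_lt_or y b q Ib Iq N) as [Gl|Gl].
  - apply (Box q Iq); lra.
  - assert (C : inC i b q) by (apply (inC_iff i x y); auto).
    specialize (Mb q Iq C); lra.
Qed.

(** This makes [b] mark its edge to [a]. A higher [e] either sees [a] in cone [x] before [b], or is
    in the parallelogram, or lies in cone [i] of [a] beyond [p] and then sees [p] in cone [x] before
    [b]. Nothing lies beyond a fictitious [p]. *)
Lemma consecutive_extreme e : child P x b e -> G i e <= G i a.
Proof.
  intros (Ie & Ce & Me).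
  destruct K as (Ka & Kb & L & L2 & Box).
  pose proof Ka as (Ia & Ca & Ma); pose proof Kb as (Ib & Cb & Mb).
  apply Rnot_lt_le; intros Li.
  destruct (proj1 (inC_iff x i y e b Dx) Ce) as [? ?].
  pose proof (inC_up _ _ _ Ce).
  assert (N : a <> e) by (intros <-; lra).
  destruct (G_lt_or y a e Ia Ie N) as [Gl|Gl].
  - assert (C : inC x e a) by (apply (inC_iff x i y); auto).
    specialize (Me a Ia C); lra.
  - destruct (G_lt_or x a e Ia Ie N) as [Gl2|Gl2].
    + apply (Box e Ie); lra.
    + assert (C : inC i a e) by (apply (inC_iff i x y); auto).
      specialize (Ma e Ie C).
      destruct (proj1 (inC_iff i x y b p D) Cb) as [? ?].
      destruct Ap as [Ip|F].
      * assert (Np : p <> e) by (intros ->; lra).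
        destruct (G_lt_or i p e Ip Ie Np) as [Gl3|Gl3]; [|lra].
        assert (C' : inC x e p) by (apply (inC_iff x i y); auto; lra).
        specialize (Me p Ip C'); lra.
      * specialize (F e Ie). apply inC_up in F; lra.
Qed.

(** In the rule [next], negative cone [y] is inspected first; its emptiness here lets the rule pass
    on to [b] in cone [x]. *)
Lemma consecutive_no_other e : ~ child P y a e.
Proof.
  intros (Ie & Ce & Me).
  destruct K as (Ka & Kb & L & L2 & Box).
  pose proof Ka as (Ia & Ca & Ma); pose proof Kb as (Ib & Cb & Mb).
  destruct (proj1 (inC_iff y i x e a Dy) Ce) as [? ?].
  destruct (proj1 (inC_iff x i y a b Dx) Cab) as [? ?].
  pose proof (inC_up _ _ _ Ce).
  assert (N : b <> e) by (intros <-; lra).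
  destruct (G_lt_or x b e Ib Ie N) as [Gl|Gl].
  - assert (C : inC y e b) by (apply (inC_iff y i x); auto; lra).
    specialize (Me b Ib C); lra.
  - destruct (G_lt_or y b e Ib Ie N) as [Gl2|Gl2].
    + apply (Box e Ie); lra.
    + assert (C : inC i b e) by (apply (inC_iff i x y); auto).
      specialize (Mb e Ie C).
      destruct (proj1 (inC_iff i x y a p D) Ca) as [? ?].
      destruct Ap as [Ip|F].
      * assert (Np : p <> e) by (intros ->; lra).
        destruct (G_lt_or i p e Ip Ie Np) as [Gl3|Gl3]; [|lra].
        assert (C' : inC y e p) by (apply (inC_iff y i x); auto; lra).
        specialize (Me p Ip C'); lra.
      * specialize (F e Ie). apply inC_up in F; lra.
Qed.

End Consecutive.

(** A signed distance along the path of siblings: it is additive and, by [edist_opp], bounds the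
    Euclidean length of each step in the direction of increasing [G x]. *)
Definition gap (x y : idx) (a b : point) : R := (G x b - G y b) - (G x a - G y a).

(** The next sibling of [c], as a child in cone [i], in the direction of increasing [G x].
    Around [c], that direction meets the negative cone [y] first and then the positive cone [x];
    the sibling is the first H-neighbour met, whether or not the parent is visible. *)
Definition next (N : point -> Prop) (i x y : idx) (c r : point) : Prop :=
  N r /\
  ((inC y r c /\ forall r', N r' -> inC y r' c -> G i r' <= G i r) \/
   ((forall r', N r' -> ~ inC y r' c) /\ inC x c r)).

Lemma next_dir N i x y c r : distinct i x y -> next N i x y c r ->
  G x c < G x r /\ G y r < G y c.
Proof.
  intros D (_ & [[C _]|[_ C]]).
  - pose proof (inC_up _ _ _ C). apply (inC_iff y i x) in C; [lra|].
    destruct (distinct_perm _ _ _ D) as (_ & _ & _ & ? & _); assumption.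
  - pose proof (inC_up _ _ _ C). apply (inC_iff x i y) in C; [lra|].
    destruct (distinct_perm _ _ _ D) as (_ & ? & _); assumption.
Qed.

Lemma nbr_child i c q : G12_nbrs P c q -> inC i c q -> child P i q c /\ In q P.
Proof. intros [_ H] C; now apply child_of_adj. Qed.

Lemma nbr_child_down i c q : G12_nbrs P c q -> inC i q c -> child P i c q /\ In c P.
Proof. intros [_ H] C; apply child_of_adj; [now apply adj_sym|assumption]. Qed.

(** Of [c] and [r], the one with smaller [G i] is the parent of the other and marks the edge. The
    two cases are the two alternatives of [next], and in each the other alternative is excluded. *)
Lemma next_of_consecutive i x y p c r : distinct i x y -> apex P i p ->
  consecutive i x y p c r ->
  next (G12_nbrs P c) i x y c r /\
  forall r', next (G12_nbrs P c) i x y c r' -> r' = r.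
Proof.
  intros D Ap K.
  pose proof K as (Kc & Kr & L1 & L2 & Box).
  pose proof Kc as (Ic & _); pose proof Kr as (Ir & _).
  assert (N : c <> r) by (intros ->; lra).
  destruct (distinct_perm _ _ _ D) as (D1 & D2 & D3 & D4 & D5).
  assert (K' : consecutive i y x p r c).
  { unfold consecutive; repeat (split; [assumption|]). eauto. }
  destruct (G_lt_or i c r Ic Ir N) as [H|H].
  - assert (C : inC y r c) by (apply (inC_iff y i x); auto).
    pose proof (consecutive_up i y x p r c D1 K' C) as U.
    pose proof (consecutive_extreme i y x p r c D1 Ap K') as X.
    assert (A : G12_nbrs P c r).
    { split; [assumption|]. apply adj_sym, (adj_extreme y c r i); auto. }
    assert (M : forall q, G12_nbrs P c q -> inC y q c -> G i q <= G i r).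
    { intros q Nq Cq; apply X. now apply nbr_child_down. }
    split; [split; auto|].
    intros r' (Nr' & [[C' M']|[F _]]).
    + apply (Ginj i); [apply Nr'|assumption|].
      apply Rle_antisym; auto.
    + destruct (F r A C).
  - assert (C : inC x c r) by (apply (inC_iff x i y); auto).
    pose proof (consecutive_up i x y p c r D K C) as U.
    pose proof (consecutive_extreme i x y p c r D Ap K) as X.
    pose proof (consecutive_no_other i x y p c r D Ap K C) as Z.
    assert (A : G12_nbrs P c r).
    { split; [assumption|]. apply (adj_extreme x r c i); auto. }
    assert (M : forall q, G12_nbrs P c q -> ~ inC y q c).
    { intros q Nq Cq; apply (Z q). now apply nbr_child_down. }
    split; [split; auto|].
    intros r' (Nr' & [[C' M']|[_ C']]).
    + destruct (M r' Nr' C').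
    + destruct (nbr_child x c r' Nr' C') as [U' Ir'].
      apply (child_unique x r' r c); auto.
Qed.

Lemma next_exists i x y p c : distinct i x y -> apex P i p -> child P i p c ->
  (exists c2, child P i p c2 /\ G x c < G x c2) ->
  exists r, next (G12_nbrs P c) i x y c r /\ consecutive i x y p c r /\
    forall r', next (G12_nbrs P c) i x y c r' -> r' = r.
Proof.
  intros D Ap Kc (c2 & K2 & L2).
  destruct (list_argmin P (fun q => child P i p q /\ G x c < G x q) (G x)) as (r & Ir & (Kr & Lr) & M).
  { exists c2; split; [apply K2|auto]. }
  assert (K : consecutive i x y p c r).
  { apply no_child_between_consecutive; auto.
    intros q Kq Lq; apply M; auto; apply Kq. }
  destruct (next_of_consecutive i x y p c r D Ap K); eauto.
Qed.

Lemma consecutive_min i x y p a b q : distinct i x y -> apex P i p -> consecutive i x y p a b ->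
  child P i p q -> G x a < G x q -> G x b <= G x q /\ G y q <= G y b.
Proof.
  intros D Ap (Ka & Kb & L1 & L2 & Box) Kq L.
  pose proof Kb as (Ib & _). pose proof Kq as (Iq & _).
  destruct (classic (b = q)) as [<-|N]; [lra|].
  destruct (distinct_perm _ _ _ D) as (D1 & D2 & D3 & D4 & D5).
  destruct (G_lt_or x b q Ib Iq N) as [H|H].
  - pose proof (child_antichain i x y p b q D Kb Kq H); lra.
  - pose proof (child_antichain i x y p q b D Kq Kb H).
    pose proof (child_antichain i x y p a q D Ka Kq L).
    exfalso; apply (Box q Iq); lra.
Qed.

Lemma next_far i x y p c r : distinct i x y -> far P i p -> child P i p c ->
  next (G12_nbrs P c) i x y c r -> exists c2, child P i p c2 /\ G x c < G x c2.
Proof.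
  intros D F Kc Nr.
  destruct (next_dir _ _ _ _ _ _ D Nr).
  pose proof Kc as (Ic & Cc & Mc).
  destruct (highest_is_child i p (fun q => G x c < G x q /\ G y q < G y c)) as (q & Kq & ? & _).
  - exists r; split; [apply Nr|auto].
  - auto.
  - intros q z Iq (? & ?) Iz Cz Lz.
    destruct (proj1 (inC_iff i x y q z D) Cz) as [? ?].
    split; [|lra].
    assert (N : c <> z) by (intros ->; lra).
    destruct (G_lt_or x c z Ic Iz N) as [Gl|Gl]; [assumption|exfalso].
    assert (C : inC i c z) by (apply (inC_iff i x y); auto; lra).
    specialize (Mc z Iz C); lra.
  - eauto.
Qed.

(** Past the last child of a real parent, the neighbour found by [next] need not be a sibling; hence
    the assumption of a further sibling. For a fictitious parent the neighbour itself proves that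
    one exists. *)
Lemma next_sound i x y p c r : distinct i x y -> apex P i p -> child P i p c ->
  ((exists c2, child P i p c2 /\ G x c < G x c2) \/ far P i p) ->
  next (G12_nbrs P c) i x y c r -> consecutive i x y p c r.
Proof.
  intros D Ap Kc H Nr.
  assert (B : exists c2, child P i p c2 /\ G x c < G x c2).
  { destruct H as [H|H]; [assumption|]. eapply next_far; eauto. }
  destruct (next_exists i x y p c D Ap Kc B) as (r0 & _ & K & U).
  now rewrite (U r Nr).
Qed.

Lemma unmarked_has_sibling i p c x : apex P i p -> child P i p c -> ~ G12_adj P c p ->
  (exists c2, child P i p c2 /\ G x c < G x c2) \/ far P i p.
Proof.
  intros [Ip|F] Kc H; [left|now right].
  apply NNPP; intros N; apply H, (adj_extreme i p c x); auto.
  intros c' K'. apply Rnot_lt_le; intros L; eauto.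
Qed.

Lemma far_exists i : exists p, far P i p.
Proof.
  assert (B : exists M, forall q, In q P -> forall j, - M < G j q).
  { clear Ginj. induction P as [|a l [M IH]]; [exists 0; intros q []|].
    exists (Rmax M (1 + Rmax (- G I0 a) (Rmax (- G I1 a) (- G I2 a)))).
    pose proof (Rmax_l M (1 + Rmax (- G I0 a) (Rmax (- G I1 a) (- G I2 a)))).
    pose proof (Rmax_r M (1 + Rmax (- G I0 a) (Rmax (- G I1 a) (- G I2 a)))).
    pose proof (Rmax_l (- G I0 a) (Rmax (- G I1 a) (- G I2 a))).
    pose proof (Rmax_r (- G I0 a) (Rmax (- G I1 a) (- G I2 a))).
    pose proof (Rmax_l (- G I1 a) (- G I2 a)).
    pose proof (Rmax_r (- G I1 a) (- G I2 a)).
    intros q [<-|Iq] j; [destruct j; lra|]. specialize (IH q Iq j); lra. }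
  destruct B as [M B].
  pose proof sqrt3_pos.
  (* With both other coordinates at [- M], below those of all points, [p] is in cone [i] of every
     point. *)
  assert (E : exists p, forall j, j <> i -> G j p = - M).
  { exists (match i with I0 => (0, M * sqrt 3) | I1 => (- (3 * M / 2), - (M * sqrt 3 / 2))
            | I2 => (3 * M / 2, - (M * sqrt 3 / 2)) end).
    intros j; destruct i, j; intros; try congruence; cbn [G fst snd]; field; lra. }
  destruct E as [p E]. exists p. intros q Iq j N. rewrite (E j N). now apply B.
Qed.

Lemma apex_exists i s : In s P -> exists p, apex P i p /\ child P i p s.
Proof.
  intros Is. destruct (classic (exists q, In q P /\ inC i s q)) as [H|H].
  - destruct (list_argmin P (inC i s) (G i) H) as (p & Ip & Cp & M).
    exists p; split; [now left|repeat split; auto].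
  - destruct (far_exists i) as [p F]. exists p; split; [now right|].
    repeat split; [assumption|now apply F|]. intros q Iq Cq; exfalso; eauto.
Qed.

Lemma marked_exists i p s : In p P -> child P i p s ->
  exists m, child P i p m /\ G12_adj P m p /\ forall c, child P i p c -> G i c <= G i m.
Proof.
  intros Ip Ks.
  destruct (list_argmax P (child P i p) (G i)) as (m & Im & Km & M).
  { exists s; split; [apply Ks|assumption]. }
  exists m; split; [assumption|split].
  - apply (adj_extreme i p m i); auto. intros c Kc; apply M; auto; apply Kc.
  - intros c Kc; apply M; auto; apply Kc.
Qed.

End Children.

(** * The routing rule *)

(** [Main j]: [j] is the positive cone preferred when [t] is in a negative cone.
    [Search i x e s0 r]: looking for the parent of [s0] in cone [i] among the siblings
    of [s0], currently in the direction of increasing [G x] up to distance [r]; on failure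
    return to [s0] and continue with cone [e].
    [Descend k j]: walking along the children, in negative cone [k], of some vertex
    towards the one to which the message must descend. *)
Inductive mode : Type :=
  | Main (j : idx)
  | Search (i x e : idx) (s0 : point) (r : R)
  | Return (i e : idx) (s0 : point)
  | Descend (k j : idx).

(** For [m = k] this is the child closest to [c]; for the other [m] it is an end of the path of
    children. *)
Definition rim (N : point -> Prop) (k m : idx) (c q : point) : Prop :=
  N q /\ inC k q c /\ forall q', N q' -> inC k q' c -> G m q' <= G m q.

(** Whether a child lies in the triangle is decided from the two ends of the path alone. If both are
    on the same side of the line [G e = G e t], the comparisons settle it; if they are on different
    sides, [descend_target] gives such a child. *)
Definition no_descent (t : point) (N : point -> Prop) (j k e : idx) (c : point) : Prop :=
  forall xe xj, rim N k e c xe -> rim N k j c xj ->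
    (G e xe <= G e t -> G j t < G j xe) /\ (G e t < G e xe -> G e t < G e xj).

(** A starting radius no larger than the first step either way, so that no sibling is missed before
    the doubling begins. *)
Definition small_radius (N : point -> Prop) (i x y : idx) (c : point) (r : R) : Prop :=
  0 < r /\
  (forall n, next N i x y c n -> r <= gap x y c n) /\
  (forall n, next N i y x c n -> r <= gap y x c n).

Definition no_up (N : point -> Prop) (i : idx) (c : point) : Prop :=
  forall p, N p -> ~ inC i c p.

Definition blocked (t : point) (N : point -> Prop) (i x y : idx) (s0 : point) (r : R)
    (c : point) : Prop :=
  forall n, next N i x y c n ->
    r < gap x y s0 n \/ 2 * (G i t - G i s0) < gap x y s0 n.

(** Only the constructors without a premise [Step] move the message; the others change the
    mode in place.  With [b = G i t - G i s0], a parent of [s0] within the triangle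
    has height at most [b], hence a child seeing it within distance [2 * b] of [s0]: this caps the
    radius, and both directions have been exhausted once a direction is blocked with
    [4 * b <= r]. *)
Inductive Step (t : point) (N : point -> Prop) (c : point) :
    mode -> point -> mode -> Prop :=
  | StepUp i j x e r c' M' :
      inC i c t -> distinct i x e -> small_radius N i x e c r ->
      Step t N c (Search i x e c r) c' M' -> Step t N c (Main j) c' M'
  | StepSide j k e r c' M' :
      inC k t c -> distinct j k e -> no_descent t N j k e c ->
      small_radius N j k e c r ->
      Step t N c (Search j k e c r) c' M' -> Step t N c (Main j) c' M'
  | StepDown j k e c' :
      inC k t c -> distinct j k e -> rim N k e c c' ->
      G e c' <= G e t -> G j c' <= G j t -> Step t N c (Main j) c' (Main j)
  | StepDescend j k e xe xj c' :
      inC k t c -> distinct j k e -> rim N k e c xe -> rim N k j c xj ->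
      G e t < G e xe -> G e xj <= G e t -> rim N k k c c' ->
      Step t N c (Main j) c' (Descend k j)
  | StepDescendBack k j e c' :
      distinct j k e -> G e t < G e c -> next N k j e c c' ->
      Step t N c (Descend k j) c' (Descend k j)
  | StepDescendForth k j e c' :
      distinct j k e -> G e c <= G e t -> next N k e j c c' -> G e c' <= G e t ->
      Step t N c (Descend k j) c' (Descend k j)
  | StepDescendStop k j e n c' M' :
      distinct j k e -> G e c <= G e t -> next N k e j c n -> G e t < G e n ->
      Step t N c (Main j) c' M' -> Step t N c (Descend k j) c' M'
  | StepFound i x e s0 r p :
      N p -> inC i c p -> G i p <= G i t ->
      Step t N c (Search i x e s0 r) p (Main i)
  | StepOvershot i x e s0 r p c' M' :
      N p -> inC i c p -> G i t < G i p ->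
      Step t N c (Return i e s0) c' M' -> Step t N c (Search i x e s0 r) c' M'
  | StepForward i x y e s0 r n :
      distinct i x y -> no_up N i c -> next N i x y c n ->
      gap x y s0 n <= r -> gap x y s0 n <= 2 * (G i t - G i s0) ->
      Step t N c (Search i x e s0 r) n (Search i x e s0 r)
  | StepTurn i x y e s0 r c' M' :
      distinct i x y -> no_up N i c -> blocked t N i x y s0 r c ->
      r < 4 * (G i t - G i s0) ->
      Step t N c (Search i y e s0 (2 * r)) c' M' ->
      Step t N c (Search i x e s0 r) c' M'
  | StepAbort i x y e s0 r c' M' :
      distinct i x y -> no_up N i c -> blocked t N i x y s0 r c ->
      4 * (G i t - G i s0) <= r ->
      Step t N c (Return i e s0) c' M' -> Step t N c (Search i x e s0 r) c' M'
  | StepBack i x y e s0 c' :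
      distinct i x y -> G x c < G x s0 -> next N i x y c c' ->
      Step t N c (Return i e s0) c' (Return i e s0)
  | StepHome i e c' M' :
      Step t N c (Main e) c' M' -> Step t N c (Return i e c) c' M'.

(** * Invariants of the routing and their preservation *)

Section Routing.

Context (P : list point).
Context (Ginj : forall i p q, In p P -> In q P -> G i p = G i q -> p = q).
Context (t : point) (It : In t P) (B : R).

Local Notation nbrs := (G12_nbrs P).

(** The invariants bound [W], the length travelled so far, plus 19 times a potential by [B].
    In [Comm] no point of the triangle lies in cone [e]; in [Unc] this is not known, and
    one more height of the triangle is reserved for the exchange of [j] and [e]. *)
Definition AtTarget (s : point) (W : R) : Prop := s = t /\ W <= B.

Definition Pos (s : point) (W : R) : Prop :=
  exists i, inC i s t /\
    forall k, k <> i -> W + 19 * ((G i t - G i s) + (G k s - G k t)) <= B.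

Definition Comm (s : point) (j : idx) (W : R) : Prop :=
  exists k e, distinct j k e /\ inC k t s /\
    (forall q, In q P -> inC e s q -> G e t < G e q) /\
    W + 19 * ((G k s - G k t) + (G j t - G j s)) <= B.

Definition Unc (s : point) (j : idx) (W : R) : Prop :=
  exists k e, distinct j k e /\ inC k t s /\
    W + 19 * (2 * (G k s - G k t) + (G j t - G j s)) <= B.

Definition InvMain (s : point) (j : idx) (W : R) : Prop :=
  In s P /\ (AtTarget s W \/ Pos s W \/ Comm s j W \/ Unc s j W).

(** [S] is the sum of the radii used before the current one.  No marked sibling lies
    within the radii already explored: [r / 4] ahead and [r / 2] behind (both capped). *)
Definition SearchBounds (i x y : idx) (p s0 : point) (r : R) (c : point) (W W0 : R) : Prop :=
  0 < r /\
  (exists S, S <= r /\ (4 * (G i t - G i s0) <= r -> S <= 6 * (G i t - G i s0)) /\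
     W <= W0 + 2 * S + gap x y s0 c) /\
  gap x y s0 c <= r /\ gap x y s0 c <= 2 * (G i t - G i s0) /\
  - gap x y s0 c <= r / 2 /\ - gap x y s0 c <= 2 * (G i t - G i s0) /\
  (forall m, child P i p m -> G12_adj P m p ->
     (G x s0 < G x m /\ gap x y s0 c <= gap x y s0 m /\
       (r / 4 <= gap x y s0 m \/ 2 * (G i t - G i s0) <= gap x y s0 m)) \/
     (G y s0 < G y m /\
       (r / 2 < - gap x y s0 m \/ 2 * (G i t - G i s0) < - gap x y s0 m))).

(** The budget depends on whether the parent is within the triangle: 19 times its height pays for
    finding it, and 19 times [G i t - G i s0] for a failure and the way back. The first case of the
    last clause is a start that sees its parent at once; [SearchBounds] excludes it, having no
    marked child at [s0]. *)
Definition InvSearch (i x e : idx) (s0 : point) (r : R) (c : point) (W : R) : Prop :=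
  exists y p W0, distinct i x y /\ apex P i p /\ child P i p s0 /\ child P i p c /\
    0 < G i t - G i s0 /\
    (G i p <= G i t -> In p P /\ InvMain p i (W0 + 19 * (G i p - G i s0))) /\
    (G i t < G i p -> Comm s0 e (W0 + 19 * (G i t - G i s0))) /\
    ((c = s0 /\ G12_adj P c p /\ W <= W0 /\ 0 < r) \/ SearchBounds i x y p s0 r c W W0).

Definition InvReturn (i e : idx) (s0 c : point) (W : R) : Prop :=
  exists p x y, distinct i x y /\ apex P i p /\ child P i p s0 /\ child P i p c /\
    G x c <= G x s0 /\ Comm s0 e (W + gap x y c s0).

(** The walk aims at [v], the last child with [G e v <= G e t]; the sibling [v'] beyond it keeps
    [next] sound up to and including [v]. *)
Definition InvDescend (k j : idx) (c : point) (W : R) : Prop :=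
  exists e s0 v, distinct j k e /\ In s0 P /\ child P k s0 c /\ child P k s0 v /\
    G e v <= G e t /\
    (exists v', child P k s0 v' /\ G e v < G e v') /\
    (forall q, child P k s0 q -> G e v < G e q -> G e t < G e q) /\
    InvMain v j (W + Rabs (gap e j c v)).

Definition Inv (M : mode) (c : point) (W : R) : Prop :=
  match M with
  | Main j => InvMain c j W
  | Search i x e s0 r => InvSearch i x e s0 r c W
  | Return i e s0 => InvReturn i e s0 c W
  | Descend k j => InvDescend k j c W
  end.

Lemma Comm_mono s j W W' : W' <= W -> Comm s j W -> Comm s j W'.
Proof.
  intros L (k & e & ? & ? & ? & ?); exists k, e; repeat (split; [assumption|]); lra.
Qed.

Lemma InvMain_mono s j W W' : W' <= W -> InvMain s j W -> InvMain s j W'.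
Proof.
  intros L (I & H); split; [assumption|].
  destruct H as [[? ?]|[(i & C & H)|[H|(k & e & ? & ? & ?)]]].
  - left; split; [assumption|lra].
  - right; left; exists i; split; [assumption|]. intros k N; specialize (H k N); lra.
  - right; right; left; now apply (Comm_mono s j W).
  - right; right; right; exists k, e; repeat (split; [assumption|]); lra.
Qed.

Lemma distinct_third i x y y' : distinct i x y -> distinct i x y' -> y = y'.
Proof. unfold distinct; destruct i, x, y, y'; intuition congruence. Qed.

Lemma neg_cone_coords j k e s : distinct j k e -> inC k t s ->
  G e s < G e t /\ G j s < G j t /\ G k t < G k s.
Proof.
  intros D C. pose proof (inC_up _ _ _ C).
  apply (inC_iff k j e) in C; [intuition|].
  destruct (distinct_perm _ _ _ D) as (_ & ? & _); assumption.
Qed.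

Lemma Comm_le s j W : Comm s j W -> W <= B.
Proof.
  intros (k & e & D & C & _ & H).
  destruct (neg_cone_coords _ _ _ _ D C) as (? & ? & ?). lra.
Qed.

Lemma InvMain_le s j W : InvMain s j W -> W <= B.
Proof.
  intros (I & [[_ H]|[(i & C & H)|[H|(k & e & D & C & H)]]]); [assumption| | |].
  - destruct (distinct_ex i) as (k & l & D). specialize (H k (not_eq_sym (proj1 D))).
    pose proof (inC_up _ _ _ C). apply (inC_iff i k l) in C; [lra|assumption].
  - now apply (Comm_le s j).
  - destruct (neg_cone_coords _ _ _ _ D C) as (? & ? & ?). lra.
Qed.

Lemma neg_cone_of_dominated j k e v : distinct j k e -> In v P ->
  G e v <= G e t -> G j v <= G j t -> v = t \/ inC k t v.
Proof.
  intros D Iv He Hj. destruct (classic (v = t)) as [->|N]; [now left|right].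
  destruct (distinct_perm _ _ _ D) as (_ & D2 & _).
  apply (inC_iff k j e); [assumption|].
  destruct (G_lt_or P Ginj e v t Iv It N); [|lra].
  destruct (G_lt_or P Ginj j v t Iv It N); [auto|lra].
Qed.

(** The lost height pays for the step, and the part in cone [j] shrinks. If the emptiness in [Comm]
    failed at [v], the highest offending point would be a child of [s] beyond [v] and not past
    [G e t], against the choice of [v]. *)
Lemma descend_inv s j k e v W : distinct j k e -> inC k t s -> InvMain s j W ->
  child P k s v -> G e v <= G e t -> G j v <= G j t ->
  (forall q, child P k s q -> G e v < G e q -> G e t < G e q) ->
  InvMain v j (W + 19 * (G k s - G k v)).
Proof.
  intros D C (Is & H) Kv Le Lj X.
  destruct (distinct_perm _ _ _ D) as (D1 & D2 & D3 & D4 & D5).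
  destruct (neg_cone_coords _ _ _ _ D C) as (? & ? & ?).
  pose proof Kv as (Iv & Cv & Mv).
  pose proof (inC_up _ _ _ Cv).
  destruct (proj1 (inC_iff k j e v s D2) Cv) as [? ?].
  pose proof (G_sum _ _ _ v D); pose proof (G_sum _ _ _ t D).
  split; [assumption|].
  assert (Hle : AtTarget v (W + 19 * (G k s - G k v)) \/ inC k t v).
  { destruct (neg_cone_of_dominated j k e v D Iv Le Lj) as [->|Cvt]; [left|now right].
    split; [reflexivity|].
    destruct H as [[-> ?]|[(i & Ci & _)|[(k' & e' & D' & C' & _ & Hb)|(k' & e' & D' & C' & Hb)]]].
    - lra.
    - destruct (inC_asym _ _ _ _ C Ci).
    - rewrite <- (inC_unique _ _ _ _ C C') in Hb. lra.
    - rewrite <- (inC_unique _ _ _ _ C C') in Hb. lra. }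
  destruct Hle as [Hle|Cvt]; [now left|right; right].
  destruct H as [[-> ?]|[(i & Ci & _)|[(k' & e' & D' & C' & E & Hb)|(k' & e' & D' & C' & Hb)]]].
  - lra.
  - destruct (inC_asym _ _ _ _ C Ci).
  - pose proof (inC_unique _ _ _ _ C C'); subst k'.
    rewrite <- (distinct_third _ _ _ _ D D') in E.
    left. exists k, e; split; [assumption|split; [assumption|split; [|lra]]].
    intros q0 Iq0 Cq0. apply Rnot_le_lt; intros Lq0.
    destruct (proj1 (inC_iff e j k v q0 D4) Cq0) as [? ?].
    pose proof (inC_up _ _ _ Cq0).
    assert (Em : forall q, In q P -> G e q <= G e t -> G k q < G k s -> G j s < G j q).
    { intros q Iq Lq Lk. apply Rnot_le_lt; intros Lq'.
      assert (N : q <> s) by (intros ->; lra).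
      destruct (G_lt_or P Ginj j q s Iq Is N); [|lra].
      assert (Cq : inC e s q) by (apply (inC_iff e j k); auto).
      specialize (E q Iq Cq); lra. }
    destruct (highest_is_child P k s
      (fun q => G e v < G e q <= G e t /\ G j s < G j q < G j v /\ G k q < G k s))
      as (q & Kq & ? & ?).
    + exists q0; split; [assumption|].
      pose proof (Em q0 Iq0 Lq0). repeat split; lra.
    + intros q Iq (? & ? & ?). apply (inC_iff k j e); [assumption|]; split; lra.
    + intros q r Iq (? & ? & ?) Ir Cr Lr.
      destruct (proj1 (inC_iff k j e q r D2) Cr) as [? ?].
      assert (G e r <= G e t) by lra.
      pose proof (Em r Ir ltac:(lra) Lr).
      assert (N : v <> r) by (intros <-; lra).
      destruct (G_lt_or P Ginj e v r Iv Ir N) as [Gl|Gl]; [repeat split; lra|exfalso].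
      assert (Cvr : inC k v r) by (apply (inC_iff k j e); auto; split; lra).
      specialize (Mv r Ir Cvr); lra.
    + specialize (X q Kq); lra.
  - pose proof (inC_unique _ _ _ _ C C'); subst k'.
    right. exists k, e; repeat (split; [assumption|]); lra.
Qed.

(** Extreme children are marked, so looking at the visible ones only loses nothing. *)
Lemma rim_iff k m c q : In c P ->
  rim (nbrs c) k m c q <->
  child P k c q /\ forall q', child P k c q' -> G m q' <= G m q.
Proof.
  intros Ic; split.
  - intros (Nq & Cq & M). split; [now apply nbr_child_down|].
    intros q' K'.
    destruct (list_argmax P (child P k c) (G m)) as (z & Iz & Kz & Mz).
    { exists q'; split; [apply K'|assumption]. }
    assert (Az : G12_adj P z c).
    { apply (adj_extreme P Ginj k c z m); auto. intros z' Kz'; apply Mz; auto; apply Kz'. }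
    apply Rle_trans with (G m z); [apply Mz; auto; apply K'|].
    apply M; [split; [assumption|now apply adj_sym]|apply Kz].
  - intros [Kq M]. split; [|split; [apply Kq|]].
    + split; [apply Kq|]. apply adj_sym, (adj_extreme P Ginj k c q m); auto.
    + intros q' N' C'. apply M. now apply nbr_child_down.
Qed.

Lemma rim_exists k m c q : In c P -> child P k c q -> exists x, rim (nbrs c) k m c x.
Proof.
  intros Ic Kq.
  destruct (list_argmax P (child P k c) (G m)) as (z & Iz & Kz & Mz).
  { exists q; split; [apply Kq|assumption]. }
  exists z; apply rim_iff; auto. split; [assumption|]. intros q' K'; apply Mz; auto; apply K'.
Qed.

Lemma no_descent_sound j k e c q : distinct j k e -> In c P -> no_descent t (nbrs c) j k e c ->
  child P k c q -> G e q <= G e t -> G j t < G j q.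
Proof.
  intros D Ic ND Kq Lq.
  destruct (distinct_perm _ _ _ D) as (D1 & D2 & D3 & D4 & D5).
  destruct (rim_exists k e c q Ic Kq) as [xe Re].
  destruct (rim_exists k j c q Ic Kq) as [xj Rj].
  destruct (ND xe xj Re Rj) as [N1 N2].
  apply rim_iff in Re, Rj; try assumption.
  destruct Re as [Ke Me], Rj as [Kj Mj].
  specialize (Me q Kq); specialize (Mj q Kq).
  assert (A : forall a b, child P k c a -> child P k c b -> G e a <= G e b -> G j b <= G j a).
  { intros a b Ka Kb L. destruct (classic (a = b)) as [->|N]; [lra|].
    destruct (G_lt_or P Ginj e a b (proj1 Ka) (proj1 Kb) N); [|lra].
    apply Rlt_le, (child_antichain P Ginj k e j c a b); auto. }
  destruct (Rle_or_lt (G e xe) (G e t)) as [L|L].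
  - pose proof (A q xe Kq Ke Me). specialize (N1 L). lra.
  - specialize (N2 L).
    destruct (classic (q = xj)) as [->|N]; [lra|].
    destruct (G_lt_or P Ginj e q xj (proj1 Kq) (proj1 Kj) N) as [Gl|Gl]; [|lra].
    pose proof (child_antichain P Ginj k e j c q xj D3 Kq Kj Gl). lra.
Qed.

(** Two consecutive children cannot lie on either side of the triangle spanned
    by [c] and [t]: the box between them would contain [t]. *)
Lemma descend_target j k e c xe xj : distinct j k e -> In c P -> inC k t c ->
  child P k c xe -> child P k c xj -> G e t < G e xe -> G e xj <= G e t ->
  exists v, child P k c v /\ G e v <= G e t /\ G j v <= G j t /\
    (exists v', child P k c v' /\ G e v < G e v') /\
    (forall q, child P k c q -> G e v < G e q -> G e t < G e q).
Proof.
  intros D Ic C Ke Kj Le Lj.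
  destruct (distinct_perm _ _ _ D) as (D1 & D2 & D3 & D4 & D5).
  destruct (list_argmax P (fun q => child P k c q /\ G e q <= G e t) (G e))
    as (v & Iv & [Kv Lv] & Mv).
  { exists xj; split; [apply Kj|auto]. }
  assert (X : forall q, child P k c q -> G e v < G e q -> G e t < G e q).
  { intros q Kq L. apply Rnot_le_lt; intros L'.
    specialize (Mv q (proj1 Kq) (conj Kq L')); lra. }
  exists v; repeat (split; [assumption || (exists xe; split; [assumption|lra])|]).
  split; [|split; [exists xe; split; [assumption|lra]|assumption]].
  apply Rnot_lt_le; intros Lt.
  destruct (list_argmin P (fun q => child P k c q /\ G e v < G e q) (G e))
    as (v' & Iv' & [Kv' Lv'] & Mv').
  { exists xe; split; [apply Ke|split; [assumption|lra]]. }
  pose proof (X v' Kv' Lv') as Xv'.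
  destruct (no_child_between_consecutive P Ginj k e j c v v' D3 Kv Kv' Lv')
    as (_ & _ & _ & _ & Box).
  { intros q Kq L; apply Mv'; auto; apply Kq. }
  assert (Nv : v <> t) by (intros ->; lra).
  assert (Nv' : v' <> t) by (intros ->; lra).
  destruct (neg_cone_coords _ _ _ _ D C) as (? & ? & ?).
  destruct (G_lt_or P Ginj e v t Iv It Nv); [|lra].
  destruct (G_lt_or P Ginj j v' t Iv' It Nv') as [Gl|Gl].
  - apply (Box t It); lra.
  - assert (C' : inC k v' t) by (apply (inC_iff k j e); auto).
    pose proof Kv' as (_ & _ & M). specialize (M t It C'); lra.
Qed.

(** * Starting a search for the parent *)

Lemma search_init i x y e p c r W : distinct i x y -> apex P i p -> child P i p c ->
  0 < G i t - G i c ->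
  (G i p <= G i t -> In p P /\ InvMain p i (W + 19 * (G i p - G i c))) ->
  (G i t < G i p -> Comm c e (W + 19 * (G i t - G i c))) ->
  small_radius (nbrs c) i x y c r ->
  InvSearch i x e c r c W.
Proof.
  intros D Ap Kc Hb Hs Hf (Hr & R1 & R2).
  destruct (distinct_perm _ _ _ D) as (D1 & D2 & D3 & D4 & D5).
  exists y, p, W; repeat (split; [assumption|]).
  destruct (classic (G12_adj P c p)) as [A|A]; [left; repeat split; auto; lra|right].
  assert (Z : gap x y c c = 0) by (unfold gap; lra).
  unfold SearchBounds; rewrite Z.
  split; [assumption|]. split; [exists 0; repeat split; lra|].
  do 4 (split; [lra|]).
  intros m Km Am.
  assert (N : c <> m) by (intros ->; auto).
  destruct (G_lt_or P Ginj x c m (proj1 Kc) (proj1 Km) N) as [L|L].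
  - left. destruct (next_exists P Ginj i x y p c D Ap Kc) as (n & Nn & Kn & _); [eauto|].
    specialize (R1 n Nn).
    destruct (consecutive_min P Ginj i x y p c n m D Ap Kn Km L).
    pose proof (child_antichain P Ginj i x y p c m D Kc Km L).
    unfold gap in *; repeat split; [assumption|lra|left; lra].
  - right. pose proof (child_antichain P Ginj i x y p m c D Km Kc L) as L2.
    destruct (next_exists P Ginj i y x p c D1 Ap Kc) as (n & Nn & Kn & _); [eauto|].
    specialize (R2 n Nn).
    destruct (consecutive_min P Ginj i y x p c n m D1 Ap Kn Km L2).
    unfold gap in *; split; [assumption|left; lra].
Qed.

(** The parent [p] is no higher than [t], so the search cannot fail. If [p] passes [t] sideways, [t]
    is in a negative cone of [p], and [Comm] holds because an offending point would lie in cone [i]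
    of [c] closer than [p]. *)
Lemma up_search i j x e c r W : InvMain c j W -> inC i c t -> distinct i x e ->
  small_radius (nbrs c) i x e c r -> InvSearch i x e c r c W.
Proof.
  intros (Ic & H) C D SR.
  assert (HP : forall k, k <> i -> W + 19 * ((G i t - G i c) + (G k c - G k t)) <= B).
  { destruct H as [[-> ?]|[(i' & Ci & H)|[(k' & e' & D' & C' & _)|(k' & e' & D' & C' & _)]]].
    - apply inC_up in C; lra.
    - rewrite (inC_unique _ _ _ _ C Ci); assumption.
    - destruct (inC_asym _ _ _ _ C C').
    - destruct (inC_asym _ _ _ _ C C'). }
  destruct (list_argmin P (inC i c) (G i)) as (p & Ip & Cp & M); [eauto|].
  assert (Kc : child P i p c) by (repeat split; auto).
  pose proof (inC_up _ _ _ C) as Up. pose proof (inC_up _ _ _ Cp) as Upp.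
  pose proof (M t It C) as Mt.
  destruct (proj1 (inC_iff i x e c t D) C) as [Cx Ce].
  destruct (proj1 (inC_iff i x e c p D) Cp) as [Px Pe].
  pose proof D as (Nix & Nxe & Nie).
  pose proof (HP x (not_eq_sym Nix)) as HPx. pose proof (HP e (not_eq_sym Nie)) as HPe.
  pose proof (G_sum _ _ _ c D); pose proof (G_sum _ _ _ t D); pose proof (G_sum _ _ _ p D).
  apply (search_init i x e e p c r W); auto; [now left|lra| |lra].
  intros _; split; [assumption|split; [assumption|]].
  destruct (classic (p = t)) as [->|N]; [left; split; [reflexivity|lra]|right].
  destruct (G_lt_or P Ginj i p t Ip It N) as [Li|Li]; [|lra].
  assert (E : forall k l, distinct i k l -> G k t < G k p -> G l p < G l t ->
    Comm p i (W + 19 * (G i p - G i c))).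
  { intros k l Dk Lk Ll.
    destruct (distinct_perm _ _ _ Dk) as (D1 & D2 & D3 & D4 & D5).
    destruct (proj1 (inC_iff i k l c t Dk) C) as [? ?].
    destruct (proj1 (inC_iff i k l c p Dk) Cp) as [? ?].
    specialize (HP k (not_eq_sym (proj1 Dk))).
    exists k, l; split; [assumption|split; [apply (inC_iff k i l); auto|split; [|lra]]].
    intros q Iq Cq. apply Rnot_le_lt; intros Lq.
    destruct (proj1 (inC_iff l i k p q D4) Cq) as [? ?].
    assert (C' : inC i c q) by (apply (inC_iff i k l); auto; lra).
    specialize (M q Iq C'); lra. }
  destruct (G_lt_or P Ginj x p t Ip It N) as [Lx|Lx];
    destruct (G_lt_or P Ginj e p t Ip It N) as [Le|Le]; [lra| | |].
  - right; left. apply (E e x); auto. apply (distinct_perm _ _ _ D).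
  - right; left. apply (E x e); auto.
  - left. exists i; split; [apply (inC_iff i x e); auto|].
    intros k Nk. specialize (HP k Nk). pose proof (Cp k Nk). lra.
Qed.

(** Otherwise every point of the region containing [q0] lies in negative cone [k] of [c], and the
    highest one is a child in the triangle. *)
Lemma lateral_point j k e c b q0 : distinct j k e -> In c P ->
  (forall q, child P k c q -> G e q <= G e t -> G j t < G j q) ->
  (forall q, In q P -> inC e c q -> G e t < G e q) ->
  b <= G j t -> In q0 P -> G e q0 <= G e t -> G j q0 <= b -> G k q0 < G k c ->
  exists q, In q P /\ inC j c q /\ G j q <= b.
Proof.
  intros D Ic ND E Lb Iq0 Le0 Lj0 Lk0.
  destruct (distinct_perm _ _ _ D) as (D1 & D2 & D3 & D4 & D5).
  apply NNPP; intros Hj.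
  assert (Ej : forall q, In q P -> G e q <= G e t -> G k q < G k c -> G j c < G j q).
  { intros q Iq Lq Lk. apply Rnot_le_lt; intros Lq'.
    assert (N : q <> c) by (intros ->; lra).
    destruct (G_lt_or P Ginj j q c Iq Ic N); [|lra].
    assert (Cq : inC e c q) by (apply (inC_iff e j k); auto).
    specialize (E q Iq Cq); lra. }
  assert (Ee : forall q, In q P -> G j q <= b -> G k q < G k c -> G e c < G e q).
  { intros q Iq Lq Lk. apply Rnot_le_lt; intros Lq'.
    assert (N : q <> c) by (intros ->; lra).
    destruct (G_lt_or P Ginj e q c Iq Ic N); [|lra].
    apply Hj; exists q; split; [assumption|split; [apply (inC_iff j k e); auto|assumption]]. }
  destruct (highest_is_child P k c
    (fun q => G e q <= G e t /\ G j q <= b /\ G k q < G k c)) as (q & Kq & ? & ? & ?).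
  - exists q0; auto.
  - intros q Iq (? & ? & ?). apply (inC_iff k j e); auto.
  - intros q r Iq (? & ? & ?) Ir Cr Lr.
    destruct (proj1 (inC_iff k j e q r D2) Cr) as [? ?]. repeat split; lra.
  - specialize (ND q Kq); lra.
Qed.

Lemma lateral_parent j k e c : distinct j k e -> In c P -> inC k t c ->
  no_descent t (nbrs c) j k e c ->
  (forall q, In q P -> inC e c q -> G e t < G e q) ->
  exists p, In p P /\ child P j p c /\ G j p <= G j t /\
    forall q, In q P -> inC e p q -> G e t < G e q.
Proof.
  intros D Ic C ND E.
  destruct (distinct_perm _ _ _ D) as (D1 & D2 & D3 & D4 & D5).
  destruct (neg_cone_coords _ _ _ _ D C) as (Let & Ljt & Lkt).
  pose proof (fun q => no_descent_sound j k e c q D Ic ND) as NDs.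
  pose proof (fun b q Lb Iq => lateral_point j k e c b q D Ic NDs E Lb Iq) as LP.
  (* Applied to [t], this gives a parent inside the triangle. *)
  destruct (LP (G j t) t) as (p0 & Ip0 & Cp0 & Lp0); auto; try lra.
  destruct (list_argmin P (inC j c) (G j)) as (p & Ip & Cp & M); [eauto|].
  pose proof (M p0 Ip0 Cp0).
  exists p; split; [assumption|split; [repeat split; auto|split; [lra|]]].
  intros q Iq Cq. apply Rnot_le_lt; intros Lq.
  destruct (proj1 (inC_iff e j k p q D4) Cq) as [? ?].
  destruct (proj1 (inC_iff j k e c p D) Cp) as [? ?].
  (* Applied to an offending [q], it gives a point of cone [j] closer than the parent. *)
  destruct (LP (G j q) q) as (q' & Iq' & Cq' & Lq'); auto; try lra.
  specialize (M q' Iq' Cq'); lra.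
Qed.

(** Under [Comm] the parent is inside the triangle. Under [Unc] a parent outside means that cone [j]
    of [c] is empty within the triangle, which is [Comm] with [j] and [e] exchanged. *)
Lemma side_search j k e c r W : InvMain c j W -> inC k t c -> distinct j k e ->
  no_descent t (nbrs c) j k e c -> small_radius (nbrs c) j k e c r ->
  InvSearch j k e c r c W.
Proof.
  intros (Ic & H) C D ND SR.
  destruct (distinct_perm _ _ _ D) as (D1 & D2 & D3 & D4 & D5).
  destruct (neg_cone_coords _ _ _ _ D C) as (Let & Ljt & Lkt).
  pose proof (G_sum _ _ _ c D); pose proof (G_sum _ _ _ t D).
  assert (L : forall p, child P j p c -> In p P -> G j p <= G j t ->
    inC k t p /\ G k p < G k c /\ G e p < G e c /\ G j c < G j p).
  { intros p (_ & Cp & _) Ip Lp. pose proof (inC_up _ _ _ Cp).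
    destruct (proj1 (inC_iff j k e c p D) Cp) as [? ?].
    split; [|auto].
    destruct (neg_cone_of_dominated j k e p D Ip) as [->|]; [lra|lra|lra|assumption]. }
  destruct H as [[-> ?]|[(i & Ci & _)|[(k' & e' & D' & C' & E & Hb)|(k' & e' & D' & C' & Hb)]]].
  - lra.
  - destruct (inC_asym _ _ _ _ C Ci).
  - pose proof (inC_unique _ _ _ _ C C'); subst k'.
    rewrite <- (distinct_third _ _ _ _ D D') in E.
    destruct (lateral_parent j k e c D Ic C ND E) as (p & Ip & Kc & Lp & Ep).
    destruct (L p Kc Ip Lp) as (Ct & Lk & Le & Lj).
    apply (search_init j k e e p c r W); auto; [now left|lra| |lra].
    intros _; split; [assumption|split; [assumption|right; right; left]].
    exists k, e; repeat (split; [assumption|]); lra.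
  - pose proof (inC_unique _ _ _ _ C C'); subst k'.
    destruct (apex_exists P j c Ic) as (p & Ap & Kc).
    apply (search_init j k e e p c r W); auto; [lra| |].
    + intros Lp.
      assert (Ip : In p P).
      { destruct Ap as [|F]; [assumption|]. specialize (F t It). apply inC_up in F; lra. }
      destruct (L p Kc Ip Lp) as (Ct & Lk & Le & Lj).
      split; [assumption|split; [assumption|right; right; right]].
      exists k, e; repeat (split; [assumption|]); lra.
    + intros Lp. exists k, j; split; [assumption|split; [assumption|split; [|lra]]].
      intros q Iq Cq. pose proof Kc as (_ & _ & M). specialize (M q Iq Cq); lra.
Qed.

(** * The moves of a search and of a descent *)

Lemma up_is_apex i p c q : apex P i p -> child P i p c -> nbrs c q -> inC i c q ->
  q = p /\ In p P.
Proof.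
  intros Ap Kc Nq Cq. destruct (nbr_child P i c q Nq Cq) as [Kq Iq].
  destruct Ap as [Ip|F].
  - split; [|assumption]. apply (child_unique P Ginj i q p c); auto.
  - exfalso. destruct Kc as (_ & _ & M). specialize (M q Iq Cq).
    pose proof (inC_up _ _ _ (F q Iq)); lra.
Qed.

Lemma no_up_iff i p c : apex P i p -> child P i p c ->
  (no_up (nbrs c) i c <-> ~ G12_adj P c p).
Proof.
  intros Ap Kc. split.
  - intros H A. destruct (adj_up P _ _ A) as (_ & Ip & _).
    apply (H p); [split; assumption|apply Kc].
  - intros A q Nq Cq. destruct (up_is_apex i p c q Ap Kc Nq Cq) as [-> _].
    apply A, Nq.
Qed.

Lemma gap_le_iff i x y p s a b : distinct i x y -> child P i p a -> child P i p b ->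
  (gap x y s a <= gap x y s b <-> G x a <= G x b).
Proof.
  intros D Ka Kb. unfold gap.
  destruct (classic (a = b)) as [->|N]; [lra|].
  destruct (G_lt_or P Ginj x a b (proj1 Ka) (proj1 Kb) N) as [L|L].
  - pose proof (child_antichain P Ginj i x y p a b D Ka Kb L); lra.
  - pose proof (child_antichain P Ginj i x y p b a D Kb Ka L); lra.
Qed.

Lemma gap_self x y a : gap x y a a = 0.
Proof. unfold gap; lra. Qed.

(** The nearest vertex known to see the parent is the child [m] closest to it,
    at distance at most twice the height [G i p - G i s0] from [s0]. *)
Lemma search_cost i x y p s0 r c W W0 : distinct i x y -> In p P ->
  child P i p s0 -> child P i p c -> G i p <= G i t ->
  SearchBounds i x y p s0 r c W W0 ->
  W <= W0 + 19 * (G i p - G i s0) /\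
  (G12_adj P c p -> W + (G i p - G i c) <= W0 + 19 * (G i p - G i s0)).
Proof.
  intros D Ip Ks Kc Lp (Hr & (S & S1 & S2 & S3) & Y1 & Y2 & Y3 & Y4 & HM).
  destruct (marked_exists P Ginj i p s0 Ip Ks) as (m & Km & Am & Mm).
  pose proof (Mm s0 Ks) as Ms.
  destruct (proj1 (inC_iff i x y s0 p D) (proj1 (proj2 Ks))) as [? ?].
  destruct (proj1 (inC_iff i x y c p D) (proj1 (proj2 Kc))) as [? ?].
  destruct (proj1 (inC_iff i x y m p D) (proj1 (proj2 Km))) as [? ?].
  pose proof (G_sum _ _ _ s0 D); pose proof (G_sum _ _ _ c D).
  pose proof (G_sum _ _ _ m D); pose proof (G_sum _ _ _ p D).
  destruct (distinct_perm _ _ _ D) as (D1 & _).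
  pose proof (fun a b Ka Kb => child_antichain P Ginj i x y p a b D Ka Kb) as AC.
  pose proof (fun a b Ka Kb => child_antichain P Ginj i y x p a b D1 Ka Kb) as AC'.
  split.
  (* Let h be the height. If [m] is ahead, r / 4 <= 2h, so 2S <= 16h, and the current gap adds at
     most 2h: 18h in all. If it is behind, r < 4h and 12h suffice. *)
  - destruct (HM m Km Am) as [(L & Z1 & Z2)|(L & Z)].
    + pose proof (AC s0 m Ks Km L). unfold gap in *. destruct Z2; lra.
    + pose proof (AC' s0 m Ks Km L). unfold gap in *. destruct Z; lra.
  - intros Ac. destruct (HM c Kc Ac) as [(Lc & _ & Zc)|(Lc & Zc)].
    2: { pose proof (AC' s0 c Ks Kc Lc). unfold gap in *. destruct Zc; lra. }
    pose proof (AC s0 c Ks Kc Lc).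
    destruct (HM m Km Am) as [(L & Z1 & Z2)|(L & Z)].
    + pose proof (AC s0 m Ks Km L).
      apply (gap_le_iff i x y p s0 c m D Kc Km) in Z1.
      assert (G y m <= G y c).
      { destruct (Rle_lt_or_eq_dec _ _ Z1) as [Z|Z]; [specialize (AC c m Kc Km Z); lra|].
        rewrite (Ginj x c m (proj1 Kc) (proj1 Km) Z); lra. }
      unfold gap in *. destruct Zc; lra.
    + pose proof (AC' s0 m Ks Km L). unfold gap in *. destruct Z; lra.
Qed.

Lemma InvSearch_le i x e s0 r c W : InvSearch i x e s0 r c W -> W <= B.
Proof.
  intros (y & p & W0 & D & Ap & Ks & Kc & Hb & Hs & Hf & H).
  destruct (Rle_or_lt (G i p) (G i t)) as [L|L].
  - destruct (Hs L) as [Ip HI]. apply InvMain_le in HI.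
    pose proof (inC_up _ _ _ (proj1 (proj2 Ks))).
    destruct H as [(_ & _ & H & _)|H]; [lra|].
    destruct (search_cost i x y p s0 r c W W0) as [? _]; auto; lra.
  - specialize (Hf L). apply Comm_le in Hf.
    destruct H as [(_ & _ & H & _)|(Hr & (S & S1 & S2 & S3) & Y1 & Y2 & _)]; [lra|].
    assert (S <= 6 * (G i t - G i s0)).
    { destruct (Rle_or_lt (4 * (G i t - G i s0)) r) as [L'|L']; [auto|lra]. }
    lra.
Qed.

Lemma Inv_le M c W : Inv M c W -> W <= B.
Proof.
  destruct M; simpl.
  - apply InvMain_le.
  - apply InvSearch_le.
  - intros (p & x & y & D & _ & Ks & Kc & L & H). apply Comm_le in H.
    apply (gap_le_iff i x y p c c s0 D Kc Ks) in L. rewrite gap_self in L. lra.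
  - intros (e & s0 & v & _ & _ & _ & _ & _ & _ & _ & H). apply InvMain_le in H.
    pose proof (Rabs_pos (gap e j c v)). lra.
Qed.

(** With [b = G i t - G i s0] and [S <= 6 * b], the search costs at most 12b + 2b and the way back
    at most 2b, within the 19b reserved. *)
Lemma return_of_search i x y e p s0 r c W W0 : distinct i x y -> apex P i p ->
  child P i p s0 -> child P i p c -> 0 < G i t - G i s0 ->
  Comm s0 e (W0 + 19 * (G i t - G i s0)) -> SearchBounds i x y p s0 r c W W0 ->
  0 <= gap x y s0 c -> InvReturn i e s0 c W.
Proof.
  intros D Ap Ks Kc Hb Hf (Hr & (S & S1 & S2 & S3) & Y1 & Y2 & _) Y0.
  exists p, y, x. destruct (distinct_perm _ _ _ D) as (D1 & _).
  repeat (split; [assumption|]). split.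
  - apply (gap_le_iff i y x p s0 c s0 D1 Kc Ks). rewrite gap_self. unfold gap in *; lra.
  - apply Comm_mono with (2 := Hf).
    assert (S <= 6 * (G i t - G i s0)).
    { destruct (Rle_or_lt (4 * (G i t - G i s0)) r) as [L'|L']; [auto|lra]. }
    unfold gap in *; lra.
Qed.

Lemma overshot_inv i x e s0 r c W q : InvSearch i x e s0 r c W ->
  nbrs c q -> inC i c q -> G i t < G i q -> InvReturn i e s0 c W.
Proof.
  intros (y & p & W0 & D & Ap & Ks & Kc & Hb & Hs & Hf & H) Nq Cq L.
  destruct (up_is_apex i p c q Ap Kc Nq Cq) as [-> Ip].
  specialize (Hf L). destruct H as [(-> & _ & H & _)|H].
  - exists p, x, y. repeat (split; [assumption|]). split; [lra|].
    rewrite gap_self. apply Comm_mono with (2 := Hf). lra.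
  - eapply return_of_search; eauto.
    destruct H as (Hr & _ & _ & _ & Y3 & Y4 & HM).
    destruct (HM c Kc (proj2 Nq)) as [(_ & _ & Z)|(_ & Z)]; destruct Z; lra.
Qed.

(** Before the walk is back at [s0], the next sibling is not past [s0], so it exceeds no radius. *)
Lemma blocked_gap_nonneg i x y p s0 r c : distinct i x y -> apex P i p ->
  child P i p s0 -> child P i p c -> 0 < r -> 0 < G i t - G i s0 ->
  blocked t (nbrs c) i x y s0 r c -> 0 <= gap x y s0 c.
Proof.
  intros D Ap Ks Kc Hr Hb Bl. apply Rnot_lt_le; intros L.
  assert (Lx : G x c < G x s0).
  { apply Rnot_le_lt; intros L'. apply (gap_le_iff i x y p s0 s0 c D Ks Kc) in L'.
    rewrite gap_self in L'; lra. }
  destruct (next_exists P Ginj i x y p c D Ap Kc) as (n & Nn & Kn & _); [eauto|].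
  destruct (consecutive_min P Ginj i x y p c n s0 D Ap Kn Ks Lx) as [Ln _].
  apply (gap_le_iff i x y p s0 n s0 D (proj1 (proj2 Kn)) Ks) in Ln.
  rewrite gap_self in Ln. destruct (Bl n Nn); lra.
Qed.

Lemma blocked_marked i x y p s0 r c m : distinct i x y -> apex P i p ->
  child P i p s0 -> child P i p c -> ~ G12_adj P c p ->
  blocked t (nbrs c) i x y s0 r c -> child P i p m -> G12_adj P m p ->
  gap x y s0 c <= gap x y s0 m ->
  r < gap x y s0 m \/ 2 * (G i t - G i s0) < gap x y s0 m.
Proof.
  intros D Ap Ks Kc Na Bl Km Am L.
  apply (gap_le_iff i x y p s0 c m D Kc Km) in L.
  assert (N : c <> m) by (intros ->; auto).
  destruct (G_lt_or P Ginj x c m (proj1 Kc) (proj1 Km) N); [|lra].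
  destruct (next_exists P Ginj i x y p c D Ap Kc) as (n & Nn & Kn & _); [eauto|].
  destruct (consecutive_min P Ginj i x y p c n m D Ap Kn Km) as [Ln _]; [assumption|].
  apply (gap_le_iff i x y p s0 n m D (proj1 (proj2 Kn)) Km) in Ln.
  destruct (Bl n Nn); lra.
Qed.

(** Ahead and behind are exchanged: the bound r / 2 behind becomes a quarter of the new radius
    ahead, and the r just explored becomes half of it behind. *)
Lemma turn_inv i x y e s0 r c W : distinct i x y -> InvSearch i x e s0 r c W ->
  no_up (nbrs c) i c -> blocked t (nbrs c) i x y s0 r c -> r < 4 * (G i t - G i s0) ->
  InvSearch i y e s0 (2 * r) c W.
Proof.
  intros D (y' & p & W0 & D' & Ap & Ks & Kc & Hb & Hs & Hf & H) NU Bl Lr.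
  rewrite <- (distinct_third _ _ _ _ D D') in H. clear y' D'.
  destruct (distinct_perm _ _ _ D) as (D1 & _).
  pose proof (proj1 (no_up_iff i p c Ap Kc) NU) as Na.
  exists x, p, W0; repeat (split; [assumption|]). right.
  destruct H as [(_ & A & _)|H]; [contradiction|].
  destruct H as (Hr & (S & S1 & S2 & S3) & Y1 & Y2 & Y3 & Y4 & HM).
  pose proof (blocked_gap_nonneg i x y p s0 r c D Ap Ks Kc Hr Hb Bl) as Y0.
  assert (E : forall q, gap y x s0 q = - gap x y s0 q) by (intros q; unfold gap; lra).
  unfold SearchBounds. rewrite E.
  split; [lra|]. split.
  (* The gap reached is at most r, so the new sum is at most 2r; as r < 4b and the gap is at most
     2b, it is also at most 6b. The gap changes sign with the direction, so the bound on [W] is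
     unchanged. *)
  { exists (S + gap x y s0 c). repeat split; lra. }
  do 4 (split; [lra|]).
  intros m Km Am. rewrite E.
  destruct (HM m Km Am) as [(L & Z1 & _)|(L & Z)].
  - right. split; [assumption|].
    destruct (blocked_marked i x y p s0 r c m D Ap Ks Kc Na Bl Km Am Z1); [left|right]; lra.
  - left. split; [assumption|]. destruct Z; (split; [lra|]); [left|right]; lra.
Qed.

(** Since r / 2 is at least twice [G i t - G i s0], both sides are explored up to the cap, while a
    parent no higher than [t] would have a marked child within it. *)
Lemma abort_inv i x y e s0 r c W : distinct i x y -> InvSearch i x e s0 r c W ->
  no_up (nbrs c) i c -> blocked t (nbrs c) i x y s0 r c -> 4 * (G i t - G i s0) <= r ->
  InvReturn i e s0 c W /\ exists p, apex P i p /\ child P i p s0 /\ G i t < G i p.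
Proof.
  intros D (y' & p & W0 & D' & Ap & Ks & Kc & Hb & Hs & Hf & H) NU Bl Lr.
  rewrite <- (distinct_third _ _ _ _ D D') in H. clear y' D'.
  pose proof (proj1 (no_up_iff i p c Ap Kc) NU) as Na.
  destruct H as [(_ & A & _)|H]; [contradiction|].
  pose proof H as (Hr & _ & Y1 & Y2 & Y3 & Y4 & HM).
  pose proof (blocked_gap_nonneg i x y p s0 r c D Ap Ks Kc Hr Hb Bl) as Y0.
  assert (L : G i t < G i p).
  { apply Rnot_le_lt; intros L. destruct (Hs L) as [Ip _].
    destruct (marked_exists P Ginj i p s0 Ip Ks) as (m & Km & Am & Mm).
    specialize (Mm s0 Ks).
    destruct (proj1 (inC_iff i x y s0 p D) (proj1 (proj2 Ks))) as [? ?].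
    destruct (proj1 (inC_iff i x y m p D) (proj1 (proj2 Km))) as [? ?].
    pose proof (G_sum _ _ _ s0 D); pose proof (G_sum _ _ _ m D).
    pose proof (G_sum _ _ _ p D).
    destruct (HM m Km Am) as [(_ & Z1 & _)|(_ & Z)].
    - destruct (blocked_marked i x y p s0 r c m D Ap Ks Kc Na Bl Km Am Z1);
        unfold gap in *; lra.
    - unfold gap in *; destruct Z; lra. }
  split; [|eauto]. eapply return_of_search; eauto.
Qed.

Lemma forward_inv i x y e s0 r c W n : distinct i x y -> InvSearch i x e s0 r c W ->
  no_up (nbrs c) i c -> next (nbrs c) i x y c n ->
  gap x y s0 n <= r -> gap x y s0 n <= 2 * (G i t - G i s0) ->
  G12_adj P c n /\ InvSearch i x e s0 r n (W + edist c n).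
Proof.
  intros D (y' & p & W0 & D' & Ap & Ks & Kc & Hb & Hs & Hf & H) NU Nn L1 L2.
  rewrite <- (distinct_third _ _ _ _ D D') in H. clear y' D'.
  pose proof (proj1 (no_up_iff i p c Ap Kc) NU) as Na.
  split; [apply Nn|].
  destruct H as [(_ & A & _)|H]; [contradiction|].
  pose proof H as (Hr & (S & S1 & S2 & S3) & Y1 & Y2 & Y3 & Y4 & HM).
  pose proof (next_sound P Ginj i x y p c n D Ap Kc
    (unmarked_has_sibling P Ginj i p c x Ap Kc Na) Nn) as Kn.
  pose proof Kn as (_ & Kn' & Lx & Ly & _).
  exists y, p, W0; repeat (split; [assumption|]). right.
  pose proof (edist_opp x y c n (proj1 (proj2 D)) (Rlt_le _ _ Lx) (Rlt_le _ _ Ly)) as Hd.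
  assert (Yn : gap x y s0 c <= gap x y s0 n) by (unfold gap; lra).
  split; [assumption|]. split.
  { exists S; repeat split; auto. unfold gap in *; lra. }
  do 4 (split; [lra|]).
  intros m Km Am. destruct (HM m Km Am) as [(L & Z1 & Z2)|Z]; [left|now right].
  split; [assumption|split; [|assumption]].
  apply (gap_le_iff i x y p s0 c m D Kc Km) in Z1.
  assert (N : c <> m) by (intros ->; auto).
  destruct (G_lt_or P Ginj x c m (proj1 Kc) (proj1 Km) N); [|lra].
  apply (gap_le_iff i x y p s0 n m D Kn' Km).
  apply (consecutive_min P Ginj i x y p c n m); auto.
Qed.

Lemma found_inv i x e s0 r c W q : InvSearch i x e s0 r c W ->
  nbrs c q -> inC i c q -> G i q <= G i t ->
  G12_adj P c q /\ InvMain q i (W + edist c q).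
Proof.
  intros (y & p & W0 & D & Ap & Ks & Kc & Hb & Hs & Hf & H) Nq Cq L.
  destruct (up_is_apex i p c q Ap Kc Nq Cq) as [-> Ip].
  split; [apply Nq|]. destruct (Hs L) as [_ HI].
  apply InvMain_mono with (2 := HI). pose proof (edist_inC _ _ _ Cq) as Hd.
  destruct H as [(-> & _ & H & _)|H].
  - pose proof (inC_up _ _ _ Cq); lra.
  - destruct (search_cost i x y p s0 r c W W0) as [_ HC]; auto.
    specialize (HC (proj2 Nq)); lra.
Qed.

Lemma back_inv i x y e s0 c W n : distinct i x y -> InvReturn i e s0 c W ->
  G x c < G x s0 -> next (nbrs c) i x y c n ->
  G12_adj P c n /\ InvReturn i e s0 n (W + edist c n).
Proof.
  intros D (p & x' & y' & D' & Ap & Ks & Kc & L & HC) Lx Nn.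
  (* The invariant leaves the direction open; the antichain property allows only the one leading to
     [s0]. *)
  assert (E : x' = x /\ y' = y).
  { destruct (distinct_perm _ _ _ D) as (D1 & _).
    destruct (distinct_perm _ _ _ D') as (D1' & _).
    destruct (distinct_cases _ _ _ D x') as [->|[->| ->]].
    - destruct D' as (? & _); congruence.
    - split; [reflexivity|]. eapply distinct_third; eauto.
    - exfalso. pose proof (distinct_third _ _ _ _ D1 D').
      subst y'. pose proof (child_antichain P Ginj i x y p c s0 D Kc Ks Lx). lra. }
  destruct E as [-> ->]. clear D'.
  split; [apply Nn|].
  pose proof (next_sound P Ginj i x y p c n D Ap Kc (or_introl (ex_intro _ s0 (conj Ks Lx))) Nn) as Kn.
  pose proof Kn as (_ & Kn' & Lx' & Ly & _).
  pose proof (edist_opp x y c n (proj1 (proj2 D)) (Rlt_le _ _ Lx') (Rlt_le _ _ Ly)) as Hd.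
  exists p, x, y; repeat (split; [assumption|]). split.
  - apply (consecutive_min P Ginj i x y p c n s0); auto.
  - apply Comm_mono with (2 := HC). unfold gap in *; lra.
Qed.

Lemma home_inv i e c W : InvReturn i e c c W -> Comm c e W /\ InvMain c e W.
Proof.
  intros (p & x & y & D & Ap & Ks & Kc & L & HC).
  rewrite gap_self, Rplus_0_r in HC. split; [assumption|].
  split; [apply Ks|auto].
Qed.

Lemma down_inv j k e c q W : distinct j k e -> InvMain c j W -> inC k t c ->
  rim (nbrs c) k e c q -> G e q <= G e t -> G j q <= G j t ->
  G12_adj P c q /\ InvMain q j (W + edist c q).
Proof.
  intros D H C R Le Lj. pose proof R as (Nq & Cq & _).
  split; [apply Nq|].
  apply rim_iff in R; [|apply H]. destruct R as [Kq M].
  pose proof (inC_up _ _ _ Cq). pose proof (edist_inC _ _ _ Cq) as Hd.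
  rewrite edist_sym in Hd.
  apply InvMain_mono with (W := W + 19 * (G k c - G k q)); [lra|].
  apply (descend_inv c j k e q W); auto.
  intros q' K' L. specialize (M q' K'); lra.
Qed.

Lemma descend_start_inv j k e c xe xj q W : distinct j k e -> InvMain c j W -> inC k t c ->
  rim (nbrs c) k e c xe -> rim (nbrs c) k j c xj -> G e t < G e xe -> G e xj <= G e t ->
  rim (nbrs c) k k c q ->
  G12_adj P c q /\ InvDescend k j q (W + edist c q).
Proof.
  intros D H C Re Rj Le Lj R. pose proof R as (Nq & Cq & _).
  split; [apply Nq|]. pose proof (proj1 H) as Ic.
  apply rim_iff in R, Re, Rj; try assumption.
  destruct R as [Kq M], Re as [Ke _], Rj as [Kj _].
  destruct (descend_target j k e c xe xj) as (v & Kv & Lv & Lv' & Ex & X); auto.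
  exists e, c, v; repeat (split; [assumption|]).
  apply InvMain_mono with (W := W + 19 * (G k c - G k v));
    [|apply (descend_inv c j k e v W); auto].
  pose proof (edist_inC _ _ _ Cq) as Hd. rewrite edist_sym in Hd.
  specialize (M v Kv).
  destruct (distinct_perm _ _ _ D) as (D1 & D2 & D3 & D4 & D5).
  destruct (proj1 (inC_iff k j e q c D2) Cq) as [? ?].
  destruct (proj1 (inC_iff k j e v c D2) (proj1 (proj2 Kv))) as [? ?].
  pose proof (G_sum _ _ _ c D); pose proof (G_sum _ _ _ q D); pose proof (G_sum _ _ _ v D).
  (* The edge to the closest child costs at most the height of [v] and the walk twice that, well
     within the factor 19. *)
  assert (Rabs (gap e j q v) <= 2 * (G k c - G k v)) by (apply Rabs_le; unfold gap; lra).
  lra.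
Qed.

Lemma descend_back_inv k j e c n W : distinct j k e -> InvDescend k j c W ->
  G e t < G e c -> next (nbrs c) k j e c n ->
  G12_adj P c n /\ InvDescend k j n (W + edist c n).
Proof.
  intros D (e' & s0 & v & D' & Is & Kc & Kv & Lv & Ex & X & H) Lc Nn.
  pose proof (distinct_third _ _ _ _ D' D); subst e'. clear D'.
  destruct (distinct_perm _ _ _ D) as (D1 & D2 & D3 & D4 & D5).
  split; [apply Nn|].
  assert (L : G j c < G j v) by (apply (child_antichain P Ginj k e j s0 v c); auto; lra).
  assert (Ap : apex P k s0) by now left.
  pose proof (next_sound P Ginj k j e s0 c n D2 Ap Kc
    (or_introl (ex_intro _ v (conj Kv L))) Nn) as Kn.
  pose proof Kn as (_ & Kn' & Lx & Ly & _).
  destruct (consecutive_min P Ginj k j e s0 c n v D2 Ap Kn Kv L) as [? ?].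
  pose proof (edist_opp j e c n (proj2 (proj2 D)) (Rlt_le _ _ Lx) (Rlt_le _ _ Ly)) as Hd.
  exists e, s0, v; repeat (split; [assumption|]).
  apply InvMain_mono with (2 := H).
  rewrite !Rabs_left1 by (unfold gap; lra). unfold gap; lra.
Qed.

Lemma descend_forth_inv k j e c n W : distinct j k e -> InvDescend k j c W ->
  G e c <= G e t -> next (nbrs c) k e j c n ->
  (G e n <= G e t -> G12_adj P c n /\ InvDescend k j n (W + edist c n)) /\
  (G e t < G e n -> InvMain c j W).
Proof.
  intros D (e' & s0 & v & D' & Is & Kc & Kv & Lv & (v' & Kv' & Lv') & X & H) Lc Nn.
  pose proof (distinct_third _ _ _ _ D' D); subst e'. clear D'.
  destruct (distinct_perm _ _ _ D) as (D1 & D2 & D3 & D4 & D5).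
  assert (Nje : e <> j) by (destruct D as (_ & _ & ?); congruence).
  assert (L : G e c <= G e v).
  { apply Rnot_lt_le; intros L. specialize (X c Kc L); lra. }
  assert (Ap : apex P k s0) by now left.
  pose proof (next_sound P Ginj k e j s0 c n D3 Ap Kc
    (or_introl (ex_intro _ v' (conj Kv' (Rle_lt_trans _ _ _ L Lv')))) Nn) as Kn.
  pose proof Kn as (_ & Kn' & Lx & Ly & _).
  split; intros Ln.
  - split; [apply Nn|].
    assert (Lnv : G e n <= G e v).
    { apply Rnot_lt_le; intros Lnv. specialize (X n Kn' Lnv); lra. }
    apply (gap_le_iff k e j s0 c c v D3 Kc Kv) in L.
    apply (gap_le_iff k e j s0 n n v D3 Kn' Kv) in Lnv.
    rewrite gap_self in L, Lnv.
    pose proof (edist_opp e j c n Nje (Rlt_le _ _ Lx) (Rlt_le _ _ Ly)) as Hd.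
    exists e, s0, v; do 5 (split; [assumption|]); split; [eauto|]; split; [assumption|].
    apply InvMain_mono with (2 := H).
    rewrite !Rabs_right by lra. unfold gap in *; lra.
  - assert (E : c = v).
    { apply NNPP; intros N.
      destruct (G_lt_or P Ginj e c v (proj1 Kc) (proj1 Kv) N); [|lra].
      destruct (consecutive_min P Ginj k e j s0 c n v D3 Ap Kn Kv); [assumption|lra]. }
    subst v. rewrite gap_self, Rabs_R0, Rplus_0_r in H. assumption.
Qed.

Lemma step_inv c M c' M' : c <> t -> Step t (nbrs c) c M c' M' ->
  forall W, Inv M c W -> G12_adj P c c' /\ Inv M' c' (W + edist c c').
Proof.
  intros Nt S. induction S as
    [i j x e r c' M' C D SR S IH|j k e r c' M' C D ND SR S IH|j k e c' C D R Le Lj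
    |j k e xe xj c' C D Re Rj Le Lj R|k j e c' D L Nn|k j e c' D L Nn Ln
    |k j e n c' M' D L Nn Ln S IH|i x e s0 r p Np Cp Lp|i x e s0 r p c' M' Np Cp Lp S IH
    |i x y e s0 r n D NU Nn L1 L2|i x y e s0 r c' M' D NU Bl Lr S IH
    |i x y e s0 r c' M' D NU Bl Lr S IH|i x y e s0 c' D L Nn|i e c' M' S IH];
    simpl; intros W H.
  - apply IH. simpl. eapply up_search; eauto.
  - apply IH. simpl. eapply side_search; eauto.
  - eapply down_inv; eauto.
  - eapply descend_start_inv; eauto.
  - eapply descend_back_inv; eauto.
  - eapply descend_forth_inv; eauto.
  - apply IH. simpl. eapply descend_forth_inv; eauto.
  - eapply found_inv; eauto.
  - apply IH. simpl. eapply overshot_inv; eauto.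
  - eapply forward_inv; eauto.
  - apply IH. simpl. eapply turn_inv; eauto.
  - apply IH. simpl. eapply abort_inv; eauto.
  - eapply back_inv; eauto.
  - apply IH. simpl. eapply home_inv; eauto.
Qed.

(** * Progress: a step exists as long as the target is not reached *)

Lemma small_radius_exists i x y c : distinct i x y -> exists r, small_radius (nbrs c) i x y c r.
Proof.
  intros D. destruct (distinct_perm _ _ _ D) as (D1 & _).
  destruct (list_pos_lower_bound P (next (nbrs c) i x y c) (gap x y c)) as (r1 & P1 & R1).
  { intros q _ Nq. destruct (next_dir _ _ _ _ _ _ D Nq). unfold gap; lra. }
  destruct (list_pos_lower_bound P (next (nbrs c) i y x c) (gap y x c)) as (r2 & P2 & R2).
  { intros q _ Nq. destruct (next_dir _ _ _ _ _ _ D1 Nq). unfold gap; lra. }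
  exists (Rmin r1 r2). pose proof (Rmin_l r1 r2); pose proof (Rmin_r r1 r2).
  split; [now apply Rmin_pos|split]; intros n Nn.
  - specialize (R1 n (proj1 (proj1 Nn)) Nn); lra.
  - specialize (R2 n (proj1 (proj1 Nn)) Nn); lra.
Qed.

Definition can_step (M : mode) (c : point) : Prop := exists c' M', Step t (nbrs c) c M c' M'.

Lemma return_can_step i e s0 c W : InvReturn i e s0 c W ->
  (c = s0 -> can_step (Main e) s0) -> can_step (Return i e s0) c.
Proof.
  intros (p & x & y & D & Ap & Ks & Kc & L & HC) HM.
  destruct (classic (c = s0)) as [->|N].
  - destruct (HM eq_refl) as (c' & M' & S). exists c', M'. now apply StepHome.
  - destruct (G_lt_or P Ginj x c s0 (proj1 Kc) (proj1 Ks) N); [|lra].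
    destruct (next_exists P Ginj i x y p c D Ap Kc) as (n & Nn & _); [eauto|].
    exists n, (Return i e s0). now apply StepBack with x y.
Qed.

(** Turning does not move the message, so several turns may precede a move; [n] bounds the doublings
    left before the search aborts. *)
Lemma search_can_step n i x e s0 r c W : InvSearch i x e s0 r c W ->
  4 * (G i t - G i s0) <= r * 2 ^ n ->
  ((exists p, apex P i p /\ child P i p s0 /\ G i t < G i p) -> can_step (Main e) s0) ->
  can_step (Search i x e s0 r) c.
Proof.
  revert x r. induction n as [|n IH]; intros x r HS Ln HM.
  all: destruct (classic (no_up (nbrs c) i c)) as [NU|NU].
  all: swap 1 2; swap 3 4.
  1, 3: apply not_all_ex_not in NU; destruct NU as [q NU];
    apply imply_to_and in NU; destruct NU as [Nq Cq]; apply NNPP in Cq;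
    destruct (Rle_or_lt (G i q) (G i t)) as [L|L];
    [exists q, (Main i); now apply StepFound
    |pose proof (overshot_inv _ _ _ _ _ _ _ _ HS Nq Cq L) as HR;
     destruct (return_can_step _ _ _ _ _ HR) as (c' & M' & S);
     [intros ->; apply HM;
      destruct HS as (y & p & W0 & D & Ap & Ks & Kc & _);
      destruct (up_is_apex i p s0 q Ap Kc Nq Cq) as [-> _]; eauto
     |exists c', M'; now apply StepOvershot with q]].
  all: pose proof HS as (y & p & W0 & D & _);
    destruct (classic (blocked t (nbrs c) i x y s0 r c)) as [Bl|Bl].
  2, 4: apply not_all_ex_not in Bl; destruct Bl as [q Bl];
    apply imply_to_and in Bl; destruct Bl as [Nq Bl];
    exists q, (Search i x e s0 r);
    apply StepForward with y; auto; apply Rnot_lt_le; intros L; apply Bl; auto.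
  all: destruct (Rle_or_lt (4 * (G i t - G i s0)) r) as [L|L].
  1, 3: destruct (abort_inv _ _ _ _ _ _ _ _ D HS NU Bl L) as [HR Ex];
    destruct (return_can_step _ _ _ _ _ HR) as (c' & M' & S);
    [intros ->; apply HM; assumption|exists c', M'; now apply StepAbort with y].
  - simpl in Ln; lra.
  - destruct (IH y (2 * r)) as (c' & M' & S).
    + eapply turn_inv; eauto.
    + simpl in Ln; lra.
    + assumption.
    + exists c', M'; now apply StepTurn with y.
Qed.

Lemma doubling r b : 0 < r -> exists n, b <= r * 2 ^ n.
Proof.
  intros Hr. destruct (Pow_x_infinity 2) with (b := b / r) as [n Hn].
  { rewrite Rabs_right; lra. }
  exists n. specialize (Hn n (le_n n)).
  rewrite Rabs_right in Hn by (apply Rle_ge, pow_le; lra).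
  apply Rge_le in Hn. apply Rmult_le_compat_l with (r := r) in Hn; [|lra].
  replace (r * (b / r)) with b in Hn by (field; lra). assumption.
Qed.

Lemma main_up_can_step i j c W : InvMain c j W -> inC i c t -> can_step (Main j) c.
Proof.
  intros H C. destruct (distinct_ex i) as (x & e & D).
  destruct (small_radius_exists i x e c D) as [r SR].
  destruct (doubling r (4 * (G i t - G i c)) (proj1 SR)) as [n Hn].
  pose proof (up_search i j x e c r W H C D SR) as HS.
  destruct (search_can_step n i x e c r c W HS Hn) as (c' & M' & S).
  - intros (p & _ & (_ & _ & M) & L). specialize (M t It C); lra.
  - exists c', M'; eapply StepUp; eauto.
Qed.

Lemma main_side_can_step j k e c W : InvMain c j W -> distinct j k e -> inC k t c ->
  (no_descent t (nbrs c) j k e c ->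
   (exists p, apex P j p /\ child P j p c /\ G j t < G j p) -> can_step (Main e) c) ->
  can_step (Main j) c.
Proof.
  intros H D C HM. pose proof (proj1 H) as Ic.
  destruct (classic (no_descent t (nbrs c) j k e c)) as [ND|ND].
  - destruct (small_radius_exists j k e c D) as [r SR].
    destruct (doubling r (4 * (G j t - G j c)) (proj1 SR)) as [n Hn].
    pose proof (side_search j k e c r W H C D ND SR) as HS.
    destruct (search_can_step n j k e c r c W HS Hn (HM ND)) as (c' & M' & S).
    exists c', M'; eapply StepSide; eauto.
  - assert (E : exists xe xj, rim (nbrs c) k e c xe /\ rim (nbrs c) k j c xj /\
      ((G e xe <= G e t /\ G j xe <= G j t) \/ (G e t < G e xe /\ G e xj <= G e t))).
    { apply NNPP; intros N; apply ND; intros xe xj Re Rj.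
      split; intros L; apply Rnot_le_lt; intros L'; apply N; exists xe, xj; auto. }
    destruct E as (xe & xj & Re & Rj & [[L1 L2]|[L1 L2]]).
    + exists xe, (Main j). eapply StepDown; eauto.
    + pose proof Re as Re'. apply rim_iff in Re'; [|assumption].
      destruct (rim_exists k k c xe Ic (proj1 Re')) as [q Rq].
      exists q, (Descend k j). eapply StepDescend; eauto.
Qed.

Lemma main_comm_can_step j c W : In c P -> Comm c j W -> can_step (Main j) c.
Proof.
  intros Ic HC. pose proof HC as (k & e & D & C & E & _).
  apply (main_side_can_step j k e c W); auto; [split; auto|].
  intros ND (p & _ & (_ & _ & M) & L).
  destruct (lateral_parent j k e c D Ic C ND E) as (p' & Ip' & (_ & Cp' & _) & L' & _).
  specialize (M p' Ip' Cp'); lra.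
Qed.

Lemma main_can_step j c W : c <> t -> InvMain c j W -> can_step (Main j) c.
Proof.
  intros Nt H. pose proof H as (Ic & [[? _]|[(i & C & _)|[HC|(k & e & D & C & _)]]]).
  - contradiction.
  - eapply main_up_can_step; eauto.
  - eapply main_comm_can_step; eauto.
  - apply (main_side_can_step j k e c W); auto.
    intros _ (p & _ & (_ & _ & M) & L).
    (* The existence of a step does not depend on the length travelled, so it is chosen to exhaust
       the budget exactly. *)
    apply (main_comm_can_step e c (B - 19 * ((G k c - G k t) + (G e t - G e c)))); [assumption|].
    exists k, j. destruct (distinct_perm _ _ _ D) as (_ & _ & _ & _ & D5).
    split; [assumption|split; [assumption|split; [|lra]]].
    intros q Iq Cq. specialize (M q Iq Cq); lra.
Qed.

Lemma step_exists M c W : c <> t -> Inv M c W -> can_step M c.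
Proof.
  intros Nt. destruct M as [j|i x e s0 r|i e s0|k j]; simpl; intros H.
  - eapply main_can_step; eauto.
  - pose proof H as (y & p & W0 & D & Ap & Ks & Kc & Hb & Hs & Hf & HB).
    assert (Hr : 0 < r) by (destruct HB as [(_ & _ & _ & Hr)|[Hr _]]; assumption).
    destruct (doubling r (4 * (G i t - G i s0)) Hr) as [n Hn].
    apply (search_can_step n i x e s0 r c W H Hn).
    intros (p' & Ap' & Ks' & L).
    apply (main_comm_can_step e s0 (W0 + 19 * (G i t - G i s0))); [apply Ks|].
    apply Hf. apply Rnot_le_lt; intros L'. destruct (Hs L') as [Ip _].
    pose proof Ks' as (_ & _ & M). specialize (M p Ip (proj1 (proj2 Ks))). lra.
  - apply (return_can_step i e s0 c W H). intros ->.
    destruct (home_inv _ _ _ _ H) as [HC [Is _]]. eapply main_comm_can_step; eauto.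
  - pose proof H as (e & s0 & v & D & Is & Kc & Kv & Lv & (v' & Kv' & Lv') & X & HM).
    destruct (distinct_perm _ _ _ D) as (D1 & D2 & D3 & D4 & D5).
    assert (Ap : apex P k s0) by now left.
    destruct (Rle_or_lt (G e c) (G e t)) as [L|L].
    + assert (L' : G e c <= G e v).
      { apply Rnot_lt_le; intros L'. specialize (X c Kc L'); lra. }
      destruct (next_exists P Ginj k e j s0 c D3 Ap Kc) as (n & Nn & _).
      { exists v'; split; [assumption|lra]. }
      destruct (descend_forth_inv k j e c n W D H L Nn) as [_ F].
      destruct (Rle_or_lt (G e n) (G e t)) as [Ln|Ln].
      * exists n, (Descend k j). eapply StepDescendForth; eauto.
      * destruct (main_can_step j c W Nt (F Ln)) as (c' & M' & S).
        exists c', M'. eapply StepDescendStop; eauto.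
    + assert (L' : G j c < G j v) by (apply (child_antichain P Ginj k e j s0 v c); auto; lra).
      destruct (next_exists P Ginj k j e s0 c D2 Ap Kc) as (n & Nn & _); [eauto|].
      exists n, (Descend k j). eapply StepDescendBack; eauto.
Qed.

End Routing.

(** * Encoding in memory and the length bounds *)

(** Stored as a point, since the bound on integer units leaves fewer than three values when [P] has
    one or two points. *)
Definition encode_idx (i : idx) : mem_unit :=
  MPt (match i with I0 => 0 | I1 => 1 | I2 => 2 end, 0).

(** The four modes are told apart by the lengths 1, 5, 3 and 2. *)
Definition encode (M : mode) : memory :=
  match M with
  | Main j => [encode_idx j]
  | Search i x e s0 r =>
      [encode_idx i; encode_idx x; encode_idx e; MPt s0; MPt (r, 0)]
  | Return i e s0 => [encode_idx i; encode_idx e; MPt s0]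
  | Descend k j => [encode_idx k; encode_idx j]
  end.

Lemma encode_idx_inj i j : encode_idx i = encode_idx j -> i = j.
Proof. unfold encode_idx; destruct i, j; intros E; try reflexivity; injection E; lra. Qed.

Lemma encode_inj M M' : encode M = encode M' -> M = M'.
Proof.
  assert (CI : forall (a b : mem_unit) l m, a :: l = b :: m -> a = b /\ l = m)
    by (intros a b l m E; now injection E).
  destruct M, M'; cbn [encode]; intros E; try discriminate E;
    repeat match goal with
    | H : cons _ _ = cons _ _ |- _ => apply CI in H; destruct H
    | H : encode_idx _ = encode_idx _ |- _ => apply encode_idx_inj in H
    end; congruence.
Qed.

Lemma encode_ok n M : mem_ok 5 n (encode M).
Proof.
  split; [destruct M; simpl; lia|].
  intros k H; exfalso.
  destruct M; simpl in H; unfold encode_idx in H; intuition congruence.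
Qed.

Definition start_dir (s t : point) (j : idx) : Prop :=
  forall k, inC k t s -> j <> k /\
    forall e, distinct j k e -> G j t - G j s <= G e t - G e s.

Lemma start_dir_exists s t : exists j, start_dir s t j.
Proof.
  destruct (classic (exists k, inC k t s)) as [[k C]|N].
  2: { exists I0. intros k C; exfalso; eauto. }
  assert (U : forall k', inC k' t s -> k' = k) by (intros; eapply inC_unique; eauto).
  destruct (distinct_ex k) as (x & y & D).
  destruct (distinct_perm _ _ _ D) as (D1 & D2 & D3 & D4 & D5).
  destruct (Rle_or_lt (G x t - G x s) (G y t - G y s)) as [L|L];
    [exists x|exists y]; intros k' C'; rewrite (U k' C').
  - split; [apply D2|]. intros e De. rewrite <- (distinct_third _ _ _ _ D2 De). lra.
  - split; [apply D4|]. intros e De. rewrite <- (distinct_third _ _ _ _ D4 De). lra.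
Qed.

(** The choice operator makes the relation [Step] a function of the local data alone. Any choice is
    good, as [step_inv] holds for every step. *)
Definition router : routing_alg := {|
  r_init s t := encode (Main (epsilon (inhabits I0) (start_dir s t)));
  r_step s t N mem := epsilon (inhabits (s, mem)) (fun q =>
    exists M M', mem = encode M /\ snd q = encode M' /\ Step t N s M (fst q) M')
|}.

Lemma router_step P (Ginj : forall i p q, In p P -> In q P -> G i p = G i q -> p = q)
    t B c M W : In t P -> c <> t -> Inv P t B M c W ->
  exists c' M', r_step router c t (G12_nbrs P c) (encode M) = (c', encode M') /\
    G12_adj P c c' /\ Inv P t B M' c' (W + edist c c').
Proof.
  intros It Nt H.
  destruct (step_exists P Ginj t It B M c W Nt H) as (c0 & M0 & S0).
  assert (E : exists q : point * memory, exists M1 M', encode M = encode M1 /\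
    snd q = encode M' /\ Step t (G12_nbrs P c) c M1 (fst q) M').
  { exists (c0, encode M0), M, M0; auto. }
  apply (epsilon_spec (inhabits (c, encode M))) in E.
  change (epsilon (inhabits (c, encode M)) _) with
    (r_step router c t (G12_nbrs P c) (encode M)) in E.
  destruct (r_step router c t (G12_nbrs P c) (encode M)) as [c' mem'].
  destruct E as (M1 & M' & E1 & E2 & S). apply encode_inj in E1; subst M1.
  simpl in E2, S; subst mem'.
  exists c', M'; split; [reflexivity|].
  apply (step_inv P Ginj t It B c M c' M'); auto.
Qed.

Lemma least_nat (Q : nat -> Prop) n : Q n ->
  exists k, Q k /\ forall i, (i < k)%nat -> ~ Q i.
Proof.
  induction n as [n IH] using (well_founded_induction Wf_nat.lt_wf). intros Qn.
  destruct (classic (exists i, (i < n)%nat /\ Q i)) as [(i & L & Qi)|N]; [eauto|].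
  exists n; split; [assumption|]. intros i L Qi; eauto.
Qed.

Lemma adj_edist_lower_bound P :
  exists d, 0 < d /\ forall a b, G12_adj P a b -> d <= edist a b.
Proof.
  destruct (list_pos_lower_bound (list_prod P P) (fun ab => G12_adj P (fst ab) (snd ab))
    (fun ab => edist (fst ab) (snd ab))) as (d & Hd & M).
  - intros [a b] _ A; simpl in *. apply edist_pos. intros <-.
    destruct (adj_up P a a A) as (_ & _ & [[i (_ & C & _)]|[i (_ & C & _)]]);
      apply inC_up in C; lra.
  - exists d; split; [assumption|]. intros a b A.
    destruct (adj_up P a b A) as (Ia & Ib & _).
    apply (M (a, b)); [now apply in_prod|assumption].
Qed.

(** The message arrives because each move adds at least the shortest edge length while the invariant
    keeps the total below [B]. *)
Lemma router_routes P (Ginj : forall i p q, In p P -> In q P -> G i p = G i q -> p = q)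
    s t B : In t P ->
  (forall j, start_dir s t j -> Inv P t B (Main j) s 0) ->
  routes_within router 5 P s t B.
Proof.
  intros It H0.
  set (st := route_state router P s t).
  assert (R : forall n, st (S n) = r_step router (fst (st n)) t
    (G12_nbrs P (fst (st n))) (snd (st n))) by reflexivity.
  assert (I : forall n, (forall i, (i < n)%nat -> fst (st i) <> t) ->
    exists M, snd (st n) = encode M /\
      Inv P t B M (fst (st n)) (route_length router P s t n)).
  { induction n as [|n IH]; intros Hn.
    - exists (Main (epsilon (inhabits I0) (start_dir s t))); split; [reflexivity|].
      apply H0, epsilon_spec, start_dir_exists.
    - destruct IH as (M & EM & HI); [intros; apply Hn; lia|].
      destruct (router_step P Ginj t B (fst (st n)) M _ It (Hn n (le_n _)) HI)
        as (c' & M' & E & A & HI').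
      exists M'.
      assert (E' : st (S n) = (c', encode M')).
      { rewrite R, EM. exact E. }
      rewrite E'; split; [reflexivity|]. simpl.
      replace (route_vertex router P s t (S n)) with c'; [exact HI'|].
      unfold route_vertex. fold st. now rewrite E'. }
  assert (A : forall n, (forall i, (i <= n)%nat -> fst (st i) <> t) ->
    G12_adj P (fst (st n)) (fst (st (S n)))).
  { intros n Hn. destruct (I n) as (M & EM & HI); [intros; apply Hn; lia|].
    destruct (router_step P Ginj t B (fst (st n)) M _ It (Hn n (le_n _)) HI)
      as (c' & M' & E & A & _).
    now rewrite R, EM, E. }
  assert (Hit : exists n, fst (st n) = t).
  { apply NNPP; intros N.
    destruct (adj_edist_lower_bound P) as (d & Hd & Md).
    assert (L : forall n, INR n * d <= route_length router P s t n).
    { induction n as [|n IH]; [simpl; lra|]. rewrite S_INR.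
      specialize (A n ltac:(intros i _ E; eauto)). apply Md in A.
      change (route_length router P s t (S n)) with
        (route_length router P s t n + edist (fst (st n)) (fst (st (S n)))).
      lra. }
    destruct (INR_unbounded (B / d)) as [n Hn].
    destruct (I n) as (M & _ & HI); [intros i _ E; eauto|].
    apply (Inv_le P Ginj) in HI.
    specialize (L n). apply Rmult_gt_compat_r with (r := d) in Hn; [|assumption].
    replace (B / d * d) with B in Hn by (field; lra). lra. }
  destruct Hit as [n Hn].
  destruct (least_nat (fun n => fst (st n) = t) n Hn) as (k & Hk & Mk).
  exists k. split; [exact Hk|split; [exact Mk|split; [|split]]].
  - intros i Li. assert (A' : G12_adj P (fst (st i)) (fst (st (S i)))).
    { apply A. intros i' Li'; apply Mk; lia. }
    split; [|exact A']. apply adj_up in A'; apply A'.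
  - intros i Li. destruct (I i) as (M & EM & _); [intros; apply Mk; lia|].
    fold st; rewrite EM; apply encode_ok.
  - destruct (I k Mk) as (M & _ & HI). now apply (Inv_le P Ginj) in HI.
Qed.

Lemma le_two_sqrt a z : 0 <= z -> a * a <= 4 * z -> a <= 2 * sqrt z.
Proof.
  intros Hz H. pose proof (sqrt_pos z).
  apply Rsqr_incr_0_var; [unfold Rsqr|lra].
  replace (2 * sqrt z * (2 * sqrt z)) with (4 * (sqrt z * sqrt z)) by ring.
  now rewrite sqrt_sqrt.
Qed.

Theorem theorem4 :
  exists (A : routing_alg) (m : nat),
    forall P : list point, NoDup P -> general_position P ->
    forall u w : point, In u P -> In w P -> in_positive_cone u w ->
      routes_within A m P u w (19 * 2 * edist u w) /\
      routes_within A m P w u (19 * (5 / sqrt 3) * edist u w).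
Proof.
  exists router, 5%nat. intros P _ GP u w Iu Iw (sec & Hsec & Csec).
  pose proof (general_position_G P GP) as Ginj.
  apply pos_sec_iff in Hsec; destruct Hsec as [i ->].
  apply in_sector_pos in Csec.
  assert (Co : forall k l, distinct i k l -> 0 < G k u - G k w /\ 0 < G l u - G l w /\
    G i w - G i u = (G k u - G k w) + (G l u - G l w)).
  { intros k l D. destruct (proj1 (inC_iff i k l u w D) Csec).
    pose proof (G_sum _ _ _ u D); pose proof (G_sum _ _ _ w D). lra. }
  split; apply router_routes; auto; intros j Hj; simpl.
  - split; [assumption|right; left]. exists i; split; [assumption|].
    intros k Nk. destruct (distinct_ex2 i k (not_eq_sym Nk)) as [l D].
    destruct (Co k l D) as (Hk & Hl & E). rewrite E.
    rewrite (edist_sqr k l) by apply D.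
    set (x := G k u - G k w) in *; set (y := G l u - G l w) in *.
    (* Height plus one lateral part is (x + y) + x, and (2x + y)^2 = 4(x^2 + xy + y^2) - 3y^2. *)
    assert (2 * x + y <= 2 * sqrt (x ^ 2 + x * y + y ^ 2)); [|lra].
    apply le_two_sqrt; nra.
  - split; [assumption|right; right; right].
    destruct (Hj i Csec) as [Nj Mj]. destruct (distinct_ex2 j i Nj) as [e D].
    specialize (Mj e D). exists i, e; split; [assumption|split; [assumption|]].
    destruct (distinct_perm _ _ _ D) as (_ & D2 & _).
    destruct (Co j e D2) as (Hk & Hl & E).
    pose proof sqrt3_pos as H3.
    (* After squaring, this is (x - y)^2 >= 0. *)
    assert (L : sqrt 3 * (G i w - G i u) <= 2 * edist u w).
    { rewrite E, (edist_sqr j e) by apply D2.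
      set (x := G j u - G j w) in *; set (y := G e u - G e w) in *.
      apply le_two_sqrt; [nra|].
      replace (sqrt 3 * (x + y) * (sqrt 3 * (x + y)))
        with ((sqrt 3 * sqrt 3) * (x + y) ^ 2) by ring.
      rewrite sqrt3_sqr. pose proof (Rle_0_sqr (x - y)) as Q. unfold Rsqr in Q. nra. }
    (* The shorter part is at most half the height, so the potential in [Unc] is at most 2 + 1/2
       heights. *)
    assert (L' : 5 / 2 * (G i w - G i u) <= 5 / sqrt 3 * edist u w).
    { apply Rmult_le_reg_l with (sqrt 3); [assumption|].
      replace (sqrt 3 * (5 / sqrt 3 * edist u w)) with (5 * edist u w) by (field; lra). lra. }
    lra.
Qed.
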